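(* Let Assumptions A and B hold, fix $\delta>0$, and run the algorithm with initialization $\sum_{i=1}^Ny_i^0=b-(\sigma^{\mathrm{ASY}}+\delta)\mathbf 1$ (i.e. restriction $r=(\sigma^{\mathrm{ASY}}+\delta)\mathbf 1$). Then there exists a finite time $T_\delta>0$ such that for all $t\ge T_\delta$ the mixed-integer vector $(x_1^t,\dots,x_N^t)$ produced by (P3) is feasible for the MILP, i.e. $x_i^t\in X_i$ for all $i$ and $\sum_{i=1}^NA_ix_i^t\preceq b$.
   Context: Data: for each $i\in\{1,\dots,N\}$, $c_i\in\mathbb{R}^{n_i}$, $A_i\in\mathbb{R}^{S\times n_i}$ (rows $A_i^s$), nonempty compact $X_i=\{x_i\in\mathbb{Z}^{Z_i}\times\mathbb{R}^{R_i}:D_ix_i\preceq d_i\}$; $b\in\mathbb{R}^S$. $\preceq$ is componentwise, $\mathbf 1$ the all-ones vector. MILP: minimize $\sum_ic_i^\top x_i$ s.t. $\sum_iA_ix_i\preceq b$, $x_i\in X_i$ (assumed feasible). Restricted LP (LP$_r$): minimize $\sum_ic_i^\top z_i$ s.t. $\sum_iA_iz_i\preceq b-r$, $z_i\in\mathrm{conv}(X_i)$. Restriction: $L_i^s=\min_{x_i\in X_i}A_i^sx_i$; $(x_i^L,\tilde\ell_i)$ optimal for minimize $\ell_i$ over $x_i\in X_i,\ell_i\in\mathbb{R}$ s.t. $A_ix_i-L_i\preceq\ell_i\mathbf 1$; $\sigma^{\mathrm{ASY}}=(S+1)\max_i\max_s(A_i^sx_i^L-L_i^s)$. Assumption A: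 (LP$_r$) with $r=(\sigma^{\mathrm{ASY}}+\delta)\mathbf 1$ is feasible with unique optimal solution. Assumption B: step-sizes $\alpha^t\ge0$, $\sum_t\alpha^t=\infty$, $\sum_t(\alpha^t)^2<\infty$. Algorithm over a connected undirected graph with neighbor sets $\mathcal N_i$, parameter $M>0$ sufficiently large. At each $t$, agent $i$: (P1) computes a primal-dual optimal pair $((z_i^t,v_i^t),\mu_i^t)$ of: minimize $c_i^\top z_i+Mv_i$ over $z_i\in\mathrm{conv}(X_i)$, $v_i\ge0$, s.t. $A_iz_i\preceq y_i^t+v_i\mathbf 1$ ($\mu_i^t$ the multiplier of this constraint); (P2) $y_i^{t+1}=y_i^t+\alpha^t\sum_{j\in\mathcal N_i}(\mu_i^t-\mu_j^t)$; (P3) computes $x_i^t$ via: minimize lexicographically $(\rho_i,\xi_i)$ over $x_i\in X_i,\rho_i\ge0,\xi_i$ s.t. $c_i^\top x_i\le\xi_i$, $A_ix_i\preceq y_i^t+\rho_i\mathbf 1$ (first minimize $\rho_i$, then $c_i^\top x_i$ with $\rho_i$ fixed at its minimum). *)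

(* Defs.v *)
(* classical reals. Vectors in R^n are functions nat -> R,
   only coordinates 0..n-1 are meaningful. Agents are indexed 0..N-1,
   coupling constraints 0..S-1. *)
From Stdlib Require Import Reals Relations.
Open Scope R_scope.

Fixpoint rsum (n : nat) (f : nat -> R) : R :=
  match n with O => 0 | Datatypes.S k => rsum k f + f k end.

(* max of f 0, ..., f (n-1) and 0 (all terms used below are >= 0) *)
Fixpoint rmaxn (n : nat) (f : nat -> R) : R :=
  match n with O => 0 | Datatypes.S k => Rmax (rmaxn k f) (f k) end.

Definition dot (n : nat) (u v : nat -> R) : R := rsum n (fun k => u k * v k).

Record milp_data := {
  nag : nat;
  ncons : nat;
  dim : nat -> nat;
  nint : nat -> nat;                  (* Z_i: the first Z_i coordinates are integer *)
  cost : nat -> nat -> R;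
  Amat : nat -> nat -> nat -> R;      (* Amat i s k = entry (s,k) of A_i *)
  nrowsD : nat -> nat;
  Dmat : nat -> nat -> nat -> R;
  dvec : nat -> nat -> R;
  bvec : nat -> R
}.

Definition Arow (P : milp_data) (i s : nat) (x : nat -> R) : R :=
  dot (dim P i) (Amat P i s) x.

Definition inX (P : milp_data) (i : nat) (x : nat -> R) : Prop :=
  (forall k, (k < nint P i)%nat -> exists z : Z, x k = IZR z) /\
  (forall r, (r < nrowsD P i)%nat -> dot (dim P i) (Dmat P i r) x <= dvec P i r).

Definition inconv (P : milp_data) (i : nat) (z : nat -> R) : Prop :=
  exists (m : nat) (lam : nat -> R) (pts : nat -> nat -> R),
    (forall j, (j < m)%nat -> 0 <= lam j /\ inX P i (pts j)) /\
    rsum m lam = 1 /\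
    (forall k, (k < dim P i)%nat -> z k = rsum m (fun j => lam j * pts j k)).

(* X_i nonempty and compact (X_i is closed, so compact = bounded) *)
Definition X_nonempty_compact (P : milp_data) : Prop :=
  forall i, (i < nag P)%nat ->
    (exists x, inX P i x) /\
    (exists B, forall x, inX P i x -> forall k, (k < dim P i)%nat -> Rabs (x k) <= B).

Definition milp_feasible_pt (P : milp_data) (x : nat -> nat -> R) : Prop :=
  (forall i, (i < nag P)%nat -> inX P i (x i)) /\
  (forall s, (s < ncons P)%nat -> rsum (nag P) (fun i => Arow P i s (x i)) <= bvec P s).

Definition milp_feasible (P : milp_data) : Prop := exists x, milp_feasible_pt P x.

Definition is_Lmin (P : milp_data) (L : nat -> nat -> R) : Prop :=
  forall i s, (i < nag P)%nat -> (s < ncons P)%nat ->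
    (exists x, inX P i x /\ Arow P i s x = L i s) /\
    (forall x, inX P i x -> L i s <= Arow P i s x).

Definition is_xL_opt (P : milp_data) (L : nat -> nat -> R)
    (xL : nat -> nat -> R) (lt : nat -> R) : Prop :=
  forall i, (i < nag P)%nat ->
    (inX P i (xL i) /\
     (forall s, (s < ncons P)%nat -> Arow P i s (xL i) - L i s <= lt i)) /\
    (forall x l, inX P i x ->
       (forall s, (s < ncons P)%nat -> Arow P i s x - L i s <= l) -> lt i <= l).

Definition sigma_asy (P : milp_data) (L : nat -> nat -> R) (xL : nat -> nat -> R) : R :=
  INR (ncons P + 1) *
  rmaxn (nag P) (fun i => rmaxn (ncons P) (fun s => Arow P i s (xL i) - L i s)).

Definition lpr_feas (P : milp_data) (rr : R) (z : nat -> nat -> R) : Prop :=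
  (forall i, (i < nag P)%nat -> inconv P i (z i)) /\
  (forall s, (s < ncons P)%nat -> rsum (nag P) (fun i => Arow P i s (z i)) <= bvec P s - rr).

Definition total_cost (P : milp_data) (z : nat -> nat -> R) : R :=
  rsum (nag P) (fun i => dot (dim P i) (cost P i) (z i)).

Definition lpr_opt (P : milp_data) (rr : R) (z : nat -> nat -> R) : Prop :=
  lpr_feas P rr z /\ forall z', lpr_feas P rr z' -> total_cost P z <= total_cost P z'.

Definition assumptionA (P : milp_data) (rr : R) : Prop :=
  exists zs, lpr_opt P rr zs /\
    forall z, lpr_opt P rr z ->
      forall i k, (i < nag P)%nat -> (k < dim P i)%nat -> z i k = zs i k.

Definition assumptionB (alpha : nat -> R) : Prop :=
  (forall t, 0 <= alpha t) /\
  cv_infty (fun T => sum_f_R0 alpha T) /\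
  (exists l, Un_cv (fun T => sum_f_R0 (fun t => alpha t ^ 2) T) l).

Definition graph_ok (N : nat) (adj : nat -> nat -> bool) : Prop :=
  (forall i j, adj i j = true -> (i < N)%nat /\ (j < N)%nat) /\
  (forall i j, adj i j = adj j i) /\
  (forall i, adj i i = false) /\
  (forall i j, (i < N)%nat -> (j < N)%nat ->
     clos_refl_trans nat (fun u w => adj u w = true) i j).

Definition loc_feas (P : milp_data) (i : nat) (y : nat -> R) (z : nat -> R) (v : R) : Prop :=
  inconv P i z /\ 0 <= v /\ (forall s, (s < ncons P)%nat -> Arow P i s z <= y s + v).

Definition loc_obj (P : milp_data) (i : nat) (M : R) (z : nat -> R) (v : R) : R :=
  dot (dim P i) (cost P i) z + M * v.

Definition loc_primal_opt (P : milp_data) (i : nat) (M : R) (y z : nat -> R) (v : R) : Prop :=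
  loc_feas P i y z v /\
  forall z' v', loc_feas P i y z' v' -> loc_obj P i M z v <= loc_obj P i M z' v'.

Definition loc_lag (P : milp_data) (i : nat) (M : R) (y : nat -> R)
    (mu : nat -> R) (z : nat -> R) (v : R) : R :=
  loc_obj P i M z v + rsum (ncons P) (fun s => mu s * (Arow P i s z - y s - v)).

(* mu is an optimal solution of the Lagrangian dual: mu >= 0 and
   q(mu') <= q(mu) for all mu' >= 0, where q(mu) = inf_{z in conv X_i, v >= 0} Lag;
   "q(mu') <= q(mu)" is written as: every lower bound of Lag(.,mu') is one of Lag(.,mu). *)
Definition loc_dual_opt (P : milp_data) (i : nat) (M : R) (y : nat -> R) (mu : nat -> R) : Prop :=
  (forall s, (s < ncons P)%nat -> 0 <= mu s) /\
  forall mu', (forall s, (s < ncons P)%nat -> 0 <= mu' s) ->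
    forall w,
      (forall z v, inconv P i z -> 0 <= v -> w <= loc_lag P i M y mu' z v) ->
      (forall z v, inconv P i z -> 0 <= v -> w <= loc_lag P i M y mu z v).

Definition primal_dual_opt (P : milp_data) (i : nat) (M : R) (y z : nat -> R) (v : R)
    (mu : nat -> R) : Prop :=
  loc_primal_opt P i M y z v /\ loc_dual_opt P i M y mu.

Definition p3_feas (P : milp_data) (i : nat) (y x : nat -> R) (rho xi : R) : Prop :=
  inX P i x /\ 0 <= rho /\ dot (dim P i) (cost P i) x <= xi /\
  (forall s, (s < ncons P)%nat -> Arow P i s x <= y s + rho).

Definition p3_lexopt (P : milp_data) (i : nat) (y x : nat -> R) (rho xi : R) : Prop :=
  p3_feas P i y x rho xi /\
  forall x' rho' xi', p3_feas P i y x' rho' xi' ->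
    rho < rho' \/ (rho = rho' /\ xi <= xi').

Definition algorithm_run (P : milp_data) (adj : nat -> nat -> bool) (M : R)
    (alpha : nat -> R) (y z : nat -> nat -> nat -> R) (v : nat -> nat -> R)
    (mu x : nat -> nat -> nat -> R) : Prop :=
  (forall i t, (i < nag P)%nat ->
     primal_dual_opt P i M (y i t) (z i t) (v i t) (mu i t)) /\
  (forall i t s, (i < nag P)%nat -> (s < ncons P)%nat ->
     y i (Datatypes.S t) s =
       y i t s + alpha t * rsum (nag P) (fun j => if adj i j then mu i t s - mu j t s else 0)) /\
  (forall i t, (i < nag P)%nat -> exists rho xi, p3_lexopt P i (y i t) (x i t) rho xi).

(* Main.v *)
(* The vectors y_i^t are controlled only through the weaker invariant A_i z_i* <= y_i^t + eps,
   where z* is the unique optimum of (LP_r); this is all the rounding step needs.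
   - Writing y^t = y^0 + (net outflow of edge flows), (P2) becomes a subgradient step on the
     edge flows, so the total local value converges to the optimal value f* of (LP_r): the
     squared distance to an optimal flow is a Lyapunov function, and a one-sided Lipschitz
     bound along the iterates upgrades the summability of alpha^t times the optimality gap to
     convergence, without any compactness.
   - Each X_i has finitely many extreme points, so Farkas' lemma gives strong duality for the
     local problems, exactness of the penalty M (its gap dominates the sum of the v_i^t), and,
     by uniqueness of z*, a linear bound of A_i (z_i* - z_i^t) by the gap.
   - By uniqueness and linear dependence at most S blocks z_i* lie outside X_i. The other
     agents get rho_i <= eps, those at most S agents get rho_i <= eps + sigma^ASY / (S+1). *)
Require Import Defs.
From Stdlib Require Import Reals Lra Lia List Arith ZArith Classical Relations.
Import ListNotations.
Open Scope R_scope.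

(** * Finite sums, linear forms and choice over finitely many indices *)

Lemma rsum_ext (n : nat) (f g : nat -> R) :
  (forall k, (k < n)%nat -> f k = g k) -> rsum n f = rsum n g.
Proof.
  induction n as [|n IH]; intros H; simpl; [reflexivity|].
  rewrite IH, (H n) by (intros; try apply H; lia). reflexivity.
Qed.

Lemma rsum_S (n : nat) (f : nat -> R) : rsum (S n) f = rsum n f + f n.
Proof. reflexivity. Qed.

Lemma rsum_plus (n : nat) (f g : nat -> R) :
  rsum n (fun k => f k + g k) = rsum n f + rsum n g.
Proof. induction n as [|n IH]; simpl; [|rewrite IH]; ring. Qed.

Lemma rsum_minus (n : nat) (f g : nat -> R) :
  rsum n (fun k => f k - g k) = rsum n f - rsum n g.
Proof. induction n as [|n IH]; simpl; [|rewrite IH]; ring. Qed.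

Lemma rsum_scal (n : nat) (c : R) (f : nat -> R) :
  rsum n (fun k => c * f k) = c * rsum n f.
Proof. induction n as [|n IH]; simpl; [|rewrite IH]; ring. Qed.

Lemma rsum_const (n : nat) (c : R) : rsum n (fun _ => c) = INR n * c.
Proof. induction n as [|n IH]; [simpl; ring|]. rewrite S_INR. simpl. rewrite IH. ring. Qed.

Lemma rsum_zero (n : nat) (f : nat -> R) :
  (forall k, (k < n)%nat -> f k = 0) -> rsum n f = 0.
Proof.
  intros H. rewrite (rsum_ext n f (fun _ => 0) H), rsum_const. ring.
Qed.

Lemma rsum_le (n : nat) (f g : nat -> R) :
  (forall k, (k < n)%nat -> f k <= g k) -> rsum n f <= rsum n g.
Proof.
  induction n as [|n IH]; intros H; simpl; [lra|].
  apply Rplus_le_compat; [apply IH; intros|]; apply H; lia.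
Qed.

Lemma rsum_nonneg (n : nat) (f : nat -> R) :
  (forall k, (k < n)%nat -> 0 <= f k) -> 0 <= rsum n f.
Proof.
  intros H. rewrite <- (rsum_zero n (fun _ => 0)) by reflexivity.
  apply rsum_le, H.
Qed.

Lemma rsum_swap (n m : nat) (f : nat -> nat -> R) :
  rsum n (fun i => rsum m (f i)) = rsum m (fun j => rsum n (fun i => f i j)).
Proof.
  induction n as [|n IH]; simpl.
  - symmetry. apply rsum_zero. reflexivity.
  - rewrite IH, rsum_plus. reflexivity.
Qed.

Lemma rsum_single (n i : nat) (f : nat -> R) :
  (i < n)%nat -> rsum n (fun k => if (k =? i)%nat then f k else 0) = f i.
Proof.
  induction n as [|n IH]; intros H; [lia|]. simpl.
  destruct (Nat.eqb_spec n i) as [->|E].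
  - rewrite rsum_zero; [ring|]. intros k Hk.
    destruct (Nat.eqb_spec k i); [lia|reflexivity].
  - rewrite IH by lia. ring.
Qed.

Lemma rsum_term_le (n i : nat) (f : nat -> R) :
  (forall k, (k < n)%nat -> 0 <= f k) -> (i < n)%nat -> f i <= rsum n f.
Proof.
  intros H Hi. rewrite <- (rsum_single n i f Hi). apply rsum_le.
  intros k Hk. destruct (k =? i)%nat; [lra|auto].
Qed.

Lemma dot_ext (d : nat) (h u w : nat -> R) :
  (forall k, (k < d)%nat -> u k = w k) -> dot d h u = dot d h w.
Proof. intros H. apply rsum_ext. intros k Hk. rewrite H; auto. Qed.

Lemma dot_line (d : nat) (h u w : nat -> R) (c : R) :
  dot d h (fun k => u k + c * w k) = dot d h u + c * dot d h w.
Proof.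
  unfold dot. rewrite <- rsum_scal, <- rsum_plus. apply rsum_ext. intros; ring.
Qed.

Lemma dot_comb (d n : nat) (h lam : nat -> R) (p : nat -> nat -> R) :
  dot d h (fun k => rsum n (fun j => lam j * p j k)) =
  rsum n (fun j => lam j * dot d h (p j)).
Proof.
  unfold dot.
  transitivity (rsum d (fun k => rsum n (fun j => lam j * (h k * p j k)))).
  - apply rsum_ext. intros k _. rewrite <- rsum_scal. apply rsum_ext. intros; ring.
  - rewrite rsum_swap. apply rsum_ext. intros j _. apply rsum_scal.
Qed.

Lemma dot_comb_l (d n : nat) (u h lam : nat -> R) (g : nat -> nat -> R) :
  dot d (fun k => h k + rsum n (fun j => lam j * g j k)) u =
  dot d h u + rsum n (fun j => lam j * dot d (g j) u).
Proof.
  unfold dot.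
  rewrite (rsum_ext n _ (fun j => rsum d (fun k => lam j * (g j k * u k))))
    by (intros; symmetry; apply rsum_scal).
  rewrite rsum_swap, <- rsum_plus. apply rsum_ext. intros k _.
  rewrite Rmult_plus_distr_r, (Rmult_comm (rsum n _) (u k)), <- rsum_scal.
  f_equal. apply rsum_ext. intros; ring.
Qed.

Lemma finite_choice (T : Type) (t0 : T) (Q : nat -> T -> Prop) (n : nat) :
  (forall i, (i < n)%nat -> exists a, Q i a) ->
  exists f, forall i, (i < n)%nat -> Q i (f i).
Proof.
  induction n as [|n IH]; intros H.
  - exists (fun _ => t0). lia.
  - destruct IH as [f Hf]; [intros; apply H; lia|].
    destruct (H n) as [a Ha]; [lia|].
    exists (fun i => if (i =? n)%nat then a else f i). intros i Hi.
    destruct (Nat.eqb_spec i n) as [->|E]; [exact Ha|apply Hf; lia].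
Qed.

Lemma finite_bound (Q : nat -> R -> Prop) (n : nat) :
  (forall i a b, a <= b -> Q i a -> Q i b) ->
  (forall i, (i < n)%nat -> exists a, Q i a) ->
  exists a, 0 <= a /\ forall i, (i < n)%nat -> Q i a.
Proof.
  intros Hmon H. destruct (finite_choice R 0 Q n H) as [f Hf].
  exists (rsum n (fun i => Rabs (f i))). split.
  - apply rsum_nonneg. intros; apply Rabs_pos.
  - intros i Hi. apply Hmon with (f i); [|auto].
    apply Rle_trans with (Rabs (f i)); [apply Rle_abs|].
    apply (rsum_term_le n i (fun i => Rabs (f i))); [intros; apply Rabs_pos|auto].
Qed.

(** * Farkas' lemma *)

(** A pair [(a, c)] stands for the inequality [0 <= a.m + c] in an unknown vector [m]; the cone
    collects the nonnegative combinations of the inequalities in [l]. *)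
Inductive cone (l : list ((nat -> R) * R)) : (nat -> R) -> R -> Prop :=
| cone_in a c : In (a, c) l -> cone l a c
| cone_add a c a' c' :
    cone l a c -> cone l a' c' -> cone l (fun s => a s + a' s) (c + c')
| cone_scal k a c : 0 <= k -> cone l a c -> cone l (fun s => k * a s) (k * c).

Lemma cone_trans (l l' : list ((nat -> R) * R)) (a : nat -> R) (c : R) :
  (forall a c, In (a, c) l' -> cone l a c) -> cone l' a c -> cone l a c.
Proof. intros H. induction 1; [auto|apply cone_add|apply cone_scal]; auto. Qed.

Lemma interpolation (lo up : list R) :
  (forall a b, In a lo -> In b up -> a <= b) ->
  exists x, (forall a, In a lo -> a <= x) /\ (forall b, In b up -> x <= b).
Proof.
  induction lo as [|a lo IH]; intros H.
  - clear H. induction up as [|b up IH].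
    + exists 0. split; intros ? [].
    + destruct IH as [x [_ Hx]]. exists (Rmin x b). split; [intros ? []|].
      intros b' [<-|Hb']; [apply Rmin_r|].
      apply Rle_trans with x; [apply Rmin_l|auto].
  - destruct IH as [x [Hl Hu]]; [intros; apply H; simpl; auto|].
    exists (Rmax x a). split.
    + intros a' [<-|Ha']; [apply Rmax_r|].
      apply Rle_trans with x; [auto|apply Rmax_l].
    + intros b Hb. apply Rmax_lub; [auto|apply H; simpl; auto].
Qed.

(** Induction on the number of unknowns: pairing each row positive in the last unknown with each
    negative one eliminates it. A solution of the reduced system extends, and a refutation of it
    pulls back. *)
Lemma fourier_motzkin (q : nat) : forall l : list ((nat -> R) * R),
  (exists m, forall a c, In (a, c) l -> 0 <= rsum q (fun s => a s * m s) + c) \/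
  (exists a c, cone l a c /\ (forall s, (s < q)%nat -> a s = 0) /\ c < 0).
Proof.
  induction q as [|q IH]; intros l.
  - destruct (classic (exists a c, In (a, c) l /\ c < 0)) as [(a & c & Hl & Hc)|H].
    + right. exists a, c. repeat split; [apply cone_in; auto|lia|auto].
    + left. exists (fun _ => 0). intros a c Hl. simpl.
      destruct (Rlt_le_dec c 0); [|lra]. exfalso. apply H. eauto.
  - set (zer := filter (fun r : (nat -> R) * R => if Req_EM_T (fst r q) 0 then true else false) l).
    set (pos := filter (fun r : (nat -> R) * R => if Rlt_dec 0 (fst r q) then true else false) l).
    set (neg := filter (fun r : (nat -> R) * R => if Rlt_dec (fst r q) 0 then true else false) l).
    (* Both multipliers are positive and together they cancel the coefficient at [q]. *)
    set (comb := fun pr : ((nat -> R) * R) * ((nat -> R) * R) =>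
      let (p, n) := pr in
      ((fun s => - fst n q * fst p s + fst p q * fst n s),
       - fst n q * snd p + fst p q * snd n)).
    assert (Hz : forall a c, In (a, c) zer <-> In (a, c) l /\ a q = 0).
    { intros a c. unfold zer. rewrite filter_In. simpl.
      destruct (Req_EM_T (a q) 0); intuition congruence. }
    assert (Hp : forall a c, In (a, c) pos <-> In (a, c) l /\ 0 < a q).
    { intros a c. unfold pos. rewrite filter_In. simpl.
      destruct (Rlt_dec 0 (a q)); intuition congruence. }
    assert (Hn : forall a c, In (a, c) neg <-> In (a, c) l /\ a q < 0).
    { intros a c. unfold neg. rewrite filter_In. simpl.
      destruct (Rlt_dec (a q) 0); intuition congruence. }
    destruct (IH (zer ++ map comb (list_prod pos neg)))
      as [[m Hm]|(a & c & Hcone & Ha & Hc)].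
    + left.
      set (ev := fun r : (nat -> R) * R => rsum q (fun s => fst r s * m s) + snd r).
      (* Rows of [pos] bound the new coordinate from below, rows of [neg] from above; the paired
         rows, satisfied by [m], say that these bounds are compatible. *)
      destruct (interpolation (map (fun r => - ev r / fst r q) pos)
                              (map (fun r => - ev r / fst r q) neg)) as [x [Hlo Hup]].
      { intros u w Hu Hw.
        apply in_map_iff in Hu as [[p cp] [<- Hp']].
        apply in_map_iff in Hw as [[n cn] [<- Hn']].
        pose proof (Hm _ _ (in_or_app _ _ _ (or_intror
          (in_map comb _ _ (in_prod _ _ _ _ Hp' Hn'))))) as Hpn.
        apply Hp in Hp' as [_ Hp']. apply Hn in Hn' as [_ Hn'].
        simpl in Hpn.
        rewrite (rsum_ext q _ (fun s => - n q * (p s * m s) + p q * (n s * m s))) in Hpn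
          by (intros; ring).
        rewrite rsum_plus, !rsum_scal in Hpn.
        assert (E : 0 <= - n q * ev (p, cp) + p q * ev (n, cn)) by (unfold ev; simpl; lra).
        simpl.
        apply Rmult_le_reg_r with (p q * - n q); [apply Rmult_lt_0_compat; lra|].
        replace (- ev (p, cp) / p q * (p q * - n q)) with (n q * ev (p, cp)) by (field; lra).
        replace (- ev (n, cn) / n q * (p q * - n q)) with (p q * ev (n, cn)) by (field; lra).
        lra. }
      exists (fun s => if (s =? q)%nat then x else m s). intros a c Hl. simpl.
      rewrite Nat.eqb_refl.
      rewrite (rsum_ext q _ (fun s => a s * m s)).
      2:{ intros s Hs. destruct (Nat.eqb_spec s q); [lia|reflexivity]. }
      assert (Hev : ev (a, c) = rsum q (fun s => a s * m s) + c) by reflexivity.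
      destruct (Rtotal_order (a q) 0) as [Hq|[Hq|Hq]].
      * assert (Hx : x <= - ev (a, c) / a q).
        { apply Hup. apply (in_map (fun r => - ev r / fst r q) neg (a, c)).
          apply Hn. auto. }
        apply Rmult_le_compat_neg_l with (r := a q) in Hx; [|lra].
        replace (a q * (- ev (a, c) / a q)) with (- ev (a, c)) in Hx by (field; lra).
        lra.
      * rewrite Hq. specialize (Hm a c (in_or_app _ _ _ (or_introl (proj2 (Hz a c) (conj Hl Hq))))).
        lra.
      * assert (Hx : - ev (a, c) / a q <= x).
        { apply Hlo. apply (in_map (fun r => - ev r / fst r q) pos (a, c)).
          apply Hp. auto. }
        apply Rmult_le_compat_l with (r := a q) in Hx; [|lra].
        replace (a q * (- ev (a, c) / a q)) with (- ev (a, c)) in Hx by (field; lra).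
        lra.
    + right. exists a, c.
      (* Rows of the reduced system lie in the cone of [l] and do not involve [q], so the refutation
         has coefficient 0 there as well. *)
      assert (Hrow : forall a c, In (a, c) (zer ++ map comb (list_prod pos neg)) ->
                cone l a c /\ a q = 0).
      { intros a' c' H. apply in_app_or in H as [H|H].
        - apply Hz in H as [H H']. split; [apply cone_in|]; auto.
        - apply in_map_iff in H as [[[p cp] [n cn]] [E H]].
          apply in_prod_iff in H as [H1 H2].
          apply Hp in H1 as [H1 H1']. apply Hn in H2 as [H2 H2'].
          simpl in E. injection E as <- <-. split; [|ring].
          apply (cone_add l (fun s => - n q * p s) (- n q * cp)
                            (fun s => p q * n s) (p q * cn));
            apply cone_scal; try lra; apply cone_in; auto. }
      split; [|split; [|exact Hc]].
      * apply cone_trans with (2 := Hcone). intros; apply Hrow; auto.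
      * assert (Hq : a q = 0).
        { clear Ha Hc. induction Hcone as [a c H|a c a' c' _ E _ E'|k a c _ _ E].
          - apply (Hrow a c H).
          - lra.
          - rewrite E; ring. }
        intros s Hs. destruct (Nat.eq_dec s q) as [->|E]; [auto|apply Ha; lia].
Qed.

(** The rows [(G k, f k)] and the unit rows, which ask for [m >= 0], form one system; a
    Fourier-Motzkin refutation of it yields weights [w] that violate the hypothesis. *)
Lemma farkas (n q : nat) (f : nat -> R) (G : nat -> nat -> R) :
  (forall w, (forall k, (k < n)%nat -> 0 <= w k) ->
     (forall s, (s < q)%nat -> rsum n (fun k => w k * G k s) <= 0) ->
     0 <= rsum n (fun k => w k * f k)) ->
  exists m, (forall s, (s < q)%nat -> 0 <= m s) /\
    forall k, (k < n)%nat -> 0 <= f k + rsum q (fun s => m s * G k s).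
Proof.
  intros H.
  set (unit := fun s s' : nat => if (s' =? s)%nat then 1 else 0).
  destruct (fourier_motzkin q (map (fun k => (G k, f k)) (seq 0 n) ++
                               map (fun s => (unit s, 0)) (seq 0 q)))
    as [[m Hm]|(a & c & Hcone & Ha & Hc)].
  - exists m. split.
    + intros s Hs.
      assert (Hs' : 0 <= rsum q (fun s' => unit s s' * m s') + 0).
      { apply Hm, in_or_app. right. apply (in_map (fun s => (unit s, 0))).
        apply in_seq. lia. }
      rewrite (rsum_ext q _ (fun s' => if (s' =? s)%nat then m s' else 0)) in Hs'
        by (intros s' _; unfold unit; destruct (s' =? s)%nat; ring).
      rewrite rsum_single in Hs' by auto. lra.
    + intros k Hk. specialize (Hm (G k) (f k)).
      rewrite (rsum_ext q _ (fun s => m s * G k s)) in Hm by (intros; ring).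
      rewrite Rplus_comm. apply Hm.
      apply in_or_app. left. apply (in_map (fun k => (G k, f k))).
      apply in_seq. lia.
  - exfalso.
    (* Unit rows in a derivation only add nonnegative amounts to [a], hence [<=] in the second
       clause. *)
    assert (Hw : exists w, (forall k, (k < n)%nat -> 0 <= w k) /\
              (forall s, (s < q)%nat -> rsum n (fun k => w k * G k s) <= a s) /\
              rsum n (fun k => w k * f k) = c).
    { clear Ha Hc. induction Hcone as [a c Hin|a c a' c' _ (w & W1 & W2 & W3) _ (w' & W1' & W2' & W3')
                                      |r a c Hr _ (w & W1 & W2 & W3)].
      - apply in_app_or in Hin as [Hin|Hin].
        + apply in_map_iff in Hin as [k [E Hk]]. injection E as <- <-.
          apply in_seq in Hk.
          exists (fun k' => if (k' =? k)%nat then 1 else 0). repeat split.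
          * intros k' _. destruct (k' =? k)%nat; lra.
          * intros s _.
            rewrite (rsum_ext n _ (fun k' => if (k' =? k)%nat then G k' s else 0))
              by (intros k' _; destruct (k' =? k)%nat; ring).
            rewrite rsum_single by lia. lra.
          * rewrite (rsum_ext n _ (fun k' => if (k' =? k)%nat then f k' else 0))
              by (intros k' _; destruct (k' =? k)%nat; ring).
            apply rsum_single. lia.
        + apply in_map_iff in Hin as [s [E Hs]]. injection E as <- <-.
          exists (fun _ => 0). repeat split; [intros; lra| |].
          * intros s' _. rewrite rsum_zero by (intros; ring).
            unfold unit. destruct (s' =? s)%nat; lra.
          * apply rsum_zero. intros; ring.
      - exists (fun k => w k + w' k). repeat split.
        + intros k Hk. specialize (W1 k Hk). specialize (W1' k Hk). lra.
        + intros s Hs. rewrite (rsum_ext n _ (fun k => w k * G k s + w' k * G k s))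
            by (intros; ring).
          rewrite rsum_plus. specialize (W2 s Hs). specialize (W2' s Hs). lra.
        + rewrite (rsum_ext n _ (fun k => w k * f k + w' k * f k)) by (intros; ring).
          rewrite rsum_plus. lra.
      - exists (fun k => r * w k). repeat split.
        + intros k Hk. apply Rmult_le_pos; auto.
        + intros s Hs. rewrite (rsum_ext n _ (fun k => r * (w k * G k s))) by (intros; ring).
          rewrite rsum_scal. apply Rmult_le_compat_l; auto.
        + rewrite (rsum_ext n _ (fun k => r * (w k * f k))) by (intros; ring).
          rewrite rsum_scal, W3. reflexivity. }
    destruct Hw as (w & W1 & W2 & W3).
    assert (0 <= c); [|lra].
    rewrite <- W3. apply H; [auto|].
    intros s Hs. rewrite <- (Ha s Hs). auto.
Qed.

(** * Counting selected indices, and linear dependence *)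

Fixpoint count (n : nat) (b : nat -> bool) : nat :=
  match n with O => O | S k => (count k b + if b k then 1 else 0)%nat end.

Lemma count_le (n : nat) (b b' : nat -> bool) :
  (forall i, (i < n)%nat -> b' i = true -> b i = true) ->
  (count n b' <= count n b)%nat.
Proof.
  induction n as [|n IH]; intros H; simpl; [lia|].
  assert (IH' := IH (fun i Hi => H i (Nat.lt_lt_succ_r _ _ Hi))).
  specialize (H n (Nat.lt_succ_diag_r n)).
  destruct (b' n); [rewrite H by auto|]; destruct (b n); lia.
Qed.

Lemma count_remove (n i0 : nat) (b b' : nat -> bool) :
  (forall i, (i < n)%nat -> i <> i0 -> b' i = b i) ->
  (i0 < n)%nat -> b i0 = true -> b' i0 = false -> count n b = S (count n b').
Proof.
  intros H Hi Hb Hb'. induction n as [|n IH]; [lia|]. simpl.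
  destruct (Nat.eq_dec i0 n) as [->|E].
  - rewrite Hb, Hb'.
    assert (count n b' = count n b); [|lia].
    apply Nat.le_antisymm; apply count_le; intros i Hi'; rewrite H by lia; auto.
  - rewrite IH by (intros; try apply H; lia). rewrite (H n) by lia. lia.
Qed.

Lemma count_lt (n i0 : nat) (b b' : nat -> bool) :
  (forall i, (i < n)%nat -> b' i = true -> b i = true) ->
  (i0 < n)%nat -> b i0 = true -> b' i0 = false -> (count n b' < count n b)%nat.
Proof.
  intros H Hi Hb Hb'.
  rewrite (count_remove n i0 b (fun i => if (i =? i0)%nat then false else b i)); auto.
  - apply Nat.lt_succ_r, count_le. intros i Hi' E.
    destruct (Nat.eqb_spec i i0) as [->|_]; [congruence|auto].
  - intros i _ E. destruct (Nat.eqb_spec i i0); [lia|reflexivity].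
  - rewrite Nat.eqb_refl. reflexivity.
Qed.

Lemma count_pos (n : nat) (b : nat -> bool) :
  (0 < count n b)%nat -> exists i, (i < n)%nat /\ b i = true.
Proof.
  induction n as [|n IH]; simpl; [lia|]. destruct (b n) eqn:E; intros H.
  - exists n. auto.
  - destruct IH as (i & Hi & Hb); [lia|]. exists i. auto.
Qed.

Lemma rsum_count (n : nat) (b : nat -> bool) (e c : R) :
  rsum n (fun i => if b i then e + c else e) = INR n * e + INR (count n b) * c.
Proof.
  induction n as [|n IH]; simpl rsum; [simpl; ring|]. rewrite IH, S_INR. simpl count.
  rewrite plus_INR. destruct (b n); simpl; ring.
Qed.

(** Gaussian elimination, one coordinate at a time, with the support of [theta] kept inside the
    selection [b]. *)
Lemma linear_dependence (n q : nat) : forall (b : nat -> bool) (V : nat -> nat -> R),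
  (q < count n b)%nat ->
  exists theta, (exists i, (i < n)%nat /\ theta i <> 0) /\
    (forall i, (i < n)%nat -> b i = false -> theta i = 0) /\
    forall s, (s < q)%nat -> rsum n (fun i => theta i * V i s) = 0.
Proof.
  induction q as [|q IH]; intros b V Hq.
  - destruct (count_pos n b Hq) as (i0 & Hi0 & Hb).
    exists (fun i => if (i =? i0)%nat then 1 else 0). repeat split.
    + exists i0. rewrite Nat.eqb_refl. split; [auto|lra].
    + intros i _ E. destruct (Nat.eqb_spec i i0) as [->|]; congruence.
    + lia.
  - destruct (classic (exists i0, (i0 < n)%nat /\ b i0 = true /\ V i0 q <> 0))
      as [(i0 & Hi0 & Hb & HV)|H0].
    + set (b' := fun i => if (i =? i0)%nat then false else b i).
      rewrite (count_remove n i0 b b') in Hq; auto.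
      2:{ intros i _ E. unfold b'. destruct (Nat.eqb_spec i i0); [lia|reflexivity]. }
      2:{ unfold b'. rewrite Nat.eqb_refl. reflexivity. }
      (* Projecting along the pivot [V i0] removes coordinate [q]; the number [a] below is the
         weight of [i0] that turns a dependence of the projections into one of the vectors. *)
      destruct (IH b' (fun i s => V i s - V i q / V i0 q * V i0 s))
        as (th & (i1 & Hi1 & Hth1) & Hsupp & Hth); [lia|].
      assert (Hth0 : th i0 = 0).
      { apply Hsupp; [auto|]. unfold b'. rewrite Nat.eqb_refl. reflexivity. }
      set (a := - rsum n (fun i => th i * (V i q / V i0 q))).
      assert (Hsum : forall s, rsum n (fun i => (th i + if (i =? i0)%nat then a else 0) * V i s)
                = rsum n (fun i => th i * (V i s - V i q / V i0 q * V i0 s))).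
      { intros s.
        rewrite (rsum_ext n _ (fun i => th i * V i s + if (i =? i0)%nat then a * V i s else 0))
          by (intros i _; destruct (i =? i0)%nat; ring).
        rewrite rsum_plus, rsum_single by auto.
        rewrite (rsum_ext n (fun i => th i * (_ - _))
                   (fun i => th i * V i s - V i0 s * (th i * (V i q / V i0 q))))
          by (intros; ring).
        rewrite rsum_minus, rsum_scal. unfold a. ring. }
      exists (fun i => th i + if (i =? i0)%nat then a else 0). repeat split.
      * exists i1. split; [auto|]. destruct (Nat.eqb_spec i1 i0) as [->|_]; lra.
      * intros i Hi E. destruct (Nat.eqb_spec i i0) as [->|E']; [congruence|].
        rewrite Hsupp; [ring|auto|]. unfold b'.
        destruct (Nat.eqb_spec i i0); [lia|auto].
      * intros s Hs. rewrite Hsum. destruct (Nat.eq_dec s q) as [->|E].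
        -- apply rsum_zero. intros; field; auto.
        -- apply Hth. lia.
    + destruct (IH b V) as (th & Hnz & Hsupp & Hth); [lia|].
      exists th. split; [auto|]. split; [auto|].
      intros s Hs. destruct (Nat.eq_dec s q) as [->|E]; [|apply Hth; lia].
      apply rsum_zero. intros i Hi. destruct (b i) eqn:Hb; [|rewrite Hsupp by auto; ring].
      destruct (Req_dec (V i q) 0) as [->|HV]; [ring|]. exfalso. apply H0. eauto.
Qed.

(** * Bounded mixed-integer sets have finitely many extreme points *)

(** Only finitely many codes of length [n] over [vals] exist; one representative is kept for each
    realised code, and classical logic decides which codes are realised. *)
Lemma finite_codes (T : Type) (n : nat) (c : nat -> T -> Z) (vals : list Z) :
  forall V : T -> Prop,
  (forall x, V x -> forall j, (j < n)%nat -> In (c j x) vals) ->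
  exists F : list T, (forall p, In p F -> V p) /\
    forall x, V x -> exists p, In p F /\ forall j, (j < n)%nat -> c j p = c j x.
Proof.
  induction n as [|n IH]; intros V HV.
  - destruct (classic (exists x, V x)) as [[x0 H0]|H0].
    + exists [x0]. split; [intros p [<-|[]]; auto|].
      intros x _. exists x0. split; [simpl; auto|lia].
    + exists []. split; [intros ? []|]. intros x Hx. exfalso. eauto.
  - assert (H : forall l : list Z, exists F : list T, (forall p, In p F -> V p) /\
        forall x, V x -> In (c n x) l ->
          exists p, In p F /\ forall j, (j < S n)%nat -> c j p = c j x).
    { induction l as [|a l (F & HF1 & HF2)].
      - exists []. split; [intros ? []|intros x _ []].
      - destruct (IH (fun x => V x /\ c n x = a)) as (F' & HF1' & HF2').
        { intros x [Hx _] j Hj. apply HV; auto. }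
        exists (F' ++ F). split.
        + intros p Hp. apply in_app_or in Hp as [Hp|Hp]; [apply HF1'|apply HF1]; auto.
        + intros x Hx [Ha|Ha].
          * destruct (HF2' x (conj Hx (eq_sym Ha))) as (p & Hp & Hc).
            exists p. split; [apply in_or_app; auto|].
            intros j Hj. destruct (Nat.eq_dec j n) as [->|E]; [|apply Hc; lia].
            destruct (HF1' p Hp). congruence.
          * destruct (HF2 x Hx Ha) as (p & Hp & Hc).
            exists p. split; [apply in_or_app; auto|auto]. }
    destruct (H vals) as (F & HF1 & HF2). exists F. split; auto.
Qed.

Lemma finite_argmin (m : nat) (Q : nat -> Prop) (f : nat -> R) :
  (exists r, (r < m)%nat /\ Q r) ->
  exists r, (r < m)%nat /\ Q r /\ forall r', (r' < m)%nat -> Q r' -> f r <= f r'.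
Proof.
  induction m as [|m IH]; [intros (r & Hr & _); lia|].
  intros (r0 & Hr0 & HQ0).
  destruct (classic (exists r, (r < m)%nat /\ Q r)) as [E|E].
  - destruct (IH E) as (r & Hr & HQ & Hmin).
    destruct (classic (Q m /\ f m < f r)) as [[Hm Hlt]|Hm].
    + exists m. split; [lia|]. split; [auto|]. intros r' Hr' HQ'.
      destruct (Nat.eq_dec r' m) as [->|Hne]; [lra|].
      assert (f r <= f r') by (apply Hmin; auto; lia). lra.
    + exists r. split; [lia|]. split; [auto|]. intros r' Hr' HQ'.
      destruct (Nat.eq_dec r' m) as [->|Hne]; [|apply Hmin; auto; lia].
      apply Rnot_lt_le. intros H. apply Hm. auto.
  - assert (Hm : r0 = m) by (destruct (Nat.eq_dec r0 m); [auto|]; exfalso; apply E;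
      exists r0; split; [lia|auto]). subst r0.
    exists m. split; [lia|]. split; [auto|]. intros r' Hr' HQ'.
    destruct (Nat.eq_dec r' m) as [->|Hne]; [lra|]. exfalso. apply E.
    exists r'. split; [lia|auto].
Qed.

(** Encoded through directions: with the integer coordinates and the tight rows held fixed, only the
    zero direction remains. These are the vertices of the slices of [X_i] with frozen integer
    coordinates. *)
Definition extreme (P : milp_data) (i : nat) (x : nat -> R) : Prop :=
  inX P i x /\
  forall dir, (forall k, (k < nint P i)%nat -> dir k = 0) ->
    (forall r, (r < nrowsD P i)%nat -> dot (dim P i) (Dmat P i r) x = dvec P i r ->
       dot (dim P i) (Dmat P i r) dir = 0) ->
    forall k, (k < dim P i)%nat -> dir k = 0.

(* From a non-extreme point, walk along a direction preserving the tight rows and the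
   integer coordinates until another row becomes tight. *)
Lemma descent_to_extreme (P : milp_data) (i : nat) (B : R)
  (hB : forall x, inX P i x -> forall k, (k < dim P i)%nat -> Rabs (x k) <= B)
  (h : nat -> R) : forall x, inX P i x ->
  exists p, extreme P i p /\ dot (dim P i) h p <= dot (dim P i) h x.
Proof.
  set (d := dim P i). set (D := Dmat P i). set (dv := dvec P i).
  (* The number of rows that are not tight is the measure of the induction. *)
  set (slack := fun x r => if Req_EM_T (dot d (D r) x) (dv r) then false else true).
  assert (Hind : forall n x, (count (nrowsD P i) (slack x) < n)%nat -> inX P i x ->
            exists p, extreme P i p /\ dot d h p <= dot d h x).
  2:{ intros x Hx. eapply Hind; eauto. }
  induction n as [|n IH]; intros x Hn Hx; [lia|].
  destruct (classic (extreme P i x)) as [He|He]; [exists x; split; [auto|lra]|].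
  assert (Hdir : exists dir, (forall k, (k < nint P i)%nat -> dir k = 0) /\
    (forall r, (r < nrowsD P i)%nat -> dot d (D r) x = dv r -> dot d (D r) dir = 0) /\
    (exists k, (k < d)%nat /\ dir k <> 0) /\ dot d h dir <= 0).
  { apply NNPP. intros Hno. apply He. split; [auto|]. intros dir H1 H2 k Hk.
    apply NNPP. intros Hne. apply Hno.
    destruct (Rle_lt_dec (dot d h dir) 0) as [Hs|Hs].
    - exists dir. repeat split; auto. exists k. auto.
    - assert (Hopp : forall g, dot d g (fun k => - dir k) = - dot d g dir).
      { intros g. rewrite <- (Rmult_1_l (dot d g dir)), Ropp_mult_distr_l.
        unfold dot. rewrite <- rsum_scal. apply rsum_ext. intros; ring. }
      exists (fun k => - dir k). repeat split.
      + intros k' Hk'. rewrite H1 by auto. ring.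
      + intros r Hr E. rewrite Hopp, H2 by auto. ring.
      + exists k. split; [auto|lra].
      + rewrite Hopp. lra. }
  destruct Hdir as (dir & Hint & Htight & (k0 & Hk0 & Hdir0) & Hh).
  destruct (Hx) as [HxZ HxD].
  set (tau := fun r => (dv r - dot d (D r) x) / dot d (D r) dir).
  (* Ratio test: [tau r] is the step at which row [r] becomes tight. If no row were blocking, a step
     of length [T] would carry coordinate [k0] beyond the bound [B]. *)
  destruct (finite_argmin (nrowsD P i) (fun r => 0 < dot d (D r) dir) tau)
    as (r0 & Hr0 & Hpos & Hmin).
  { apply NNPP. intros Hno.
    set (T := (B + 1 + Rabs (x k0)) / Rabs (dir k0)).
    assert (Hd : 0 < Rabs (dir k0)) by (apply Rabs_pos_lt; auto).
    assert (HB0 : Rabs (x k0) <= B) by (apply hB; auto).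
    assert (HT : 0 < T).
    { apply Rdiv_lt_0_compat; [|auto]. pose proof (Rabs_pos (x k0)). lra. }
    assert (HXT : inX P i (fun k => x k + T * dir k)).
    { split.
      - intros k Hk. destruct (HxZ k Hk) as [z Hz]. exists z. rewrite Hint by auto. lra.
      - intros r Hr. rewrite dot_line. specialize (HxD r Hr).
        assert (dot d (D r) dir <= 0).
        { apply Rnot_lt_le. intros Hlt. apply Hno. exists r. auto. }
        fold d. fold D. fold d D in HxD. nra. }
    specialize (hB _ HXT k0 Hk0).
    assert (HTd : Rabs (T * dir k0) = B + 1 + Rabs (x k0)).
    { rewrite Rabs_mult, (Rabs_pos_eq T) by lra. unfold T. field. lra. }
    pose proof (Rabs_triang (x k0 + T * dir k0) (- x k0)) as Ht.
    rewrite Rabs_Ropp in Ht.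
    replace (x k0 + T * dir k0 + - x k0) with (T * dir k0) in Ht by ring.
    lra. }
  set (t0 := tau r0).
  assert (Hr0D := HxD r0 Hr0). fold d D dv in Hr0D.
  assert (Ht0 : 0 <= t0).
  { unfold t0, tau. apply Rmult_le_pos; [lra|]. left. apply Rinv_0_lt_compat. auto. }
  assert (Hx' : inX P i (fun k => x k + t0 * dir k)).
  { split.
    - intros k Hk. destruct (HxZ k Hk) as [z Hz]. exists z. rewrite Hint by auto. lra.
    - intros r Hr. rewrite dot_line. specialize (HxD r Hr). fold d D dv in HxD |- *.
      destruct (Rlt_le_dec 0 (dot d (D r) dir)) as [Hr'|Hr']; [|nra].
      specialize (Hmin r Hr Hr'). fold t0 in Hmin.
      apply Rmult_le_compat_r with (r := dot d (D r) dir) in Hmin; [|lra].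
      unfold tau in Hmin. unfold Rdiv in Hmin.
      rewrite Rmult_assoc, Rinv_l in Hmin by lra. lra. }
  destruct (IH (fun k => x k + t0 * dir k)) as (p & Hp & Hpx); [|exact Hx'|].
  (* Tight rows stay tight along [dir] and [r0] becomes tight, so the measure drops. *)
  { enough (count (nrowsD P i) (slack (fun k => x k + t0 * dir k)%R)
      < count (nrowsD P i) (slack x))%nat by lia.
    apply count_lt with r0; auto; unfold slack.
    - intros r Hr.
      destruct (Req_EM_T (dot d (D r) x) (dv r)) as [E|E]; [|auto].
      rewrite dot_line, Htight, E, Rmult_0_r, Rplus_0_r by auto.
      destruct (Req_EM_T (dv r) (dv r)); congruence.
    - destruct (Req_EM_T (dot d (D r0) x) (dv r0)) as [E|E]; [|auto].
      rewrite Htight in Hpos by auto. lra.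
    - rewrite dot_line. unfold t0, tau.
      destruct (Req_EM_T _ _) as [E|E]; [auto|]. exfalso. apply E. field. lra. }
  exists p. split; [auto|]. rewrite dot_line in Hpx. nra.
Qed.

Definition conv (d : nat) (X : (nat -> R) -> Prop) (z : nat -> R) : Prop :=
  exists (m : nat) (lam : nat -> R) (pts : nat -> nat -> R),
    (forall j, (j < m)%nat -> 0 <= lam j /\ X (pts j)) /\
    rsum m lam = 1 /\
    (forall k, (k < d)%nat -> z k = rsum m (fun j => lam j * pts j k)).

(* Equality of the support functions of [F] and [X] means equality of their closed convex hulls. *)
Definition finite_support (d : nat) (X : (nat -> R) -> Prop) : Prop :=
  exists F : list (nat -> R), (forall p, In p F -> X p) /\
    forall h x, X x -> exists p, In p F /\ dot d h p <= dot d h x.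

(** An extreme point is determined on its first [dim P i] coordinates by its integer coordinates and
    its set of tight rows, and boundedness leaves finitely many such patterns. *)
Lemma milp_finite_support (P : milp_data) (i : nat)
  (hZ : (nint P i <= dim P i)%nat)
  (hB : exists B, forall x, inX P i x -> forall k, (k < dim P i)%nat -> Rabs (x k) <= B) :
  finite_support (dim P i) (inX P i).
Proof.
  destruct hB as [B hB].
  set (d := dim P i). set (D := Dmat P i). set (dv := dvec P i).
  (* First the integer coordinates, then one entry per row: 0 if tight, 1 if slack. *)
  set (code := fun j (x : nat -> R) =>
    if (j <? nint P i)%nat then Int_part (x j)
    else if Req_EM_T (dot d (D (j - nint P i)%nat) x) (dv (j - nint P i)%nat)
      then 0%Z else 1%Z).
  (* The summand 1 ensures that the range from [-K] to [K] also contains the entries 0 and 1. *)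
  set (K := (Z.abs (up B) + 1)%Z).
  assert (HBK : B < IZR K).
  { apply Rlt_le_trans with (IZR (up B)); [apply archimed|].
    apply IZR_le. lia. }
  assert (Hint : forall (x : nat -> R) k z, x k = IZR z -> Int_part (x k) = z).
  { intros x k z ->. symmetry. apply Int_part_spec. lra. }
  destruct (finite_codes _ (nint P i + nrowsD P i) code
      (map (fun k => Z.of_nat k - K)%Z (seq 0 (Z.to_nat (2 * K + 1)))) (extreme P i))
    as (F & HF1 & HF2).
  { assert (Hin : forall z, (- K <= z <= K)%Z ->
      In z (map (fun k => Z.of_nat k - K)%Z (seq 0 (Z.to_nat (2 * K + 1))))).
    { intros z Hz. apply in_map_iff. exists (Z.to_nat (z + K)). split; [lia|].
      apply in_seq. lia. }
    intros x [Hx _] j Hj. apply Hin. unfold code.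
    destruct (Nat.ltb_spec j (nint P i)) as [Hj'|Hj'].
    - destruct (proj1 Hx j Hj') as [z Hz]. rewrite (Hint x j z Hz).
      assert (Habs := hB x Hx j (Nat.lt_le_trans _ _ _ Hj' hZ)). rewrite Hz in Habs.
      rewrite <- abs_IZR in Habs.
      assert (IZR (Z.abs z) < IZR K) as Hlt by lra. apply lt_IZR in Hlt. lia.
    - destruct (Req_EM_T _ _); lia. }
  exists F. split; [intros p Hp; apply HF1, Hp|].
  intros h x Hx.
  destruct (descent_to_extreme P i B hB h x Hx) as (e & He & Hle).
  destruct (HF2 e He) as (p & Hp & Hcode).
  exists p. split; [auto|].
  replace (dot d h p) with (dot d h e); [exact Hle|]. apply dot_ext. intros k Hk.
  destruct (HF1 p Hp) as [[HpZ HpD] _]. destruct He as [[HeZ HeD] Hex].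
  (* The difference of two points with equal codes vanishes on the integer coordinates and on the
     rows tight at [e], so extremality of [e] applies to it. *)
  assert (E : p k - e k = 0); [|lra].
  apply (Hex (fun k => p k - e k)); [| |exact Hk].
  - intros j Hj. specialize (Hcode j ltac:(lia)). unfold code in Hcode.
    destruct (Nat.ltb_spec j (nint P i)); [|lia].
    destruct (HpZ j Hj) as [z Hz]. destruct (HeZ j Hj) as [z' Hz'].
    rewrite (Hint _ _ _ Hz), (Hint _ _ _ Hz') in Hcode. rewrite Hz, Hz', Hcode. ring.
  - intros r Hr E. specialize (Hcode (nint P i + r)%nat ltac:(lia)). unfold code in Hcode.
    destruct (Nat.ltb_spec (nint P i + r) (nint P i)); [lia|].
    replace (nint P i + r - nint P i)%nat with r in Hcode by lia.
    fold d D dv in E |- *.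
    destruct (Req_EM_T (dot d (D r) e) (dv r)) as [E1|E1]; [|congruence].
    destruct (Req_EM_T (dot d (D r) p) (dv r)) as [E2|E2]; [|congruence].
    transitivity (dot d (D r) p - dot d (D r) e); [|lra].
    unfold dot. rewrite <- rsum_minus. apply rsum_ext. intros; ring.
Qed.

(** * Convex hulls and linear programming duality *)

(** A weighted average cannot lie strictly below all the values that it averages. *)
Lemma conv_point_below (d : nat) (X : (nat -> R) -> Prop) (h z : nat -> R) :
  conv d X z -> exists x, X x /\ dot d h x <= dot d h z.
Proof.
  intros (m & lam & pts & Hpts & Hsum & Hz).
  rewrite (dot_ext d h z _ Hz), dot_comb.
  apply NNPP. intros Hno.
  set (v := rsum m (fun j => lam j * dot d h (pts j))) in *.
  assert (Hgt : forall j, (j < m)%nat -> v < dot d h (pts j)).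
  { intros j Hj. apply Rnot_le_lt. intros Hle. apply Hno. exists (pts j).
    split; [apply Hpts|]; auto. }
  assert (H0 : forall j, (j < m)%nat -> lam j = 0).
  { intros j Hj.
    assert (Hj' : lam j * (dot d h (pts j) - v) <= 0).
    { apply Rle_trans with (rsum m (fun j => lam j * (dot d h (pts j) - v))).
      - apply (rsum_term_le m j (fun j => lam j * (dot d h (pts j) - v))); [|auto].
        intros l Hl. apply Rmult_le_pos; [apply Hpts; auto|]. specialize (Hgt l Hl). lra.
      - rewrite (rsum_ext m _ (fun j => lam j * dot d h (pts j) - v * lam j))
          by (intros; ring).
        rewrite rsum_minus, rsum_scal, Hsum. fold v. lra. }
    specialize (Hgt j Hj). destruct (Hpts j Hj) as [Hl _]. nra. }
  rewrite rsum_zero in Hsum by auto. lra.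
Qed.

(** A separable linear objective is minimised block by block, so tuples drawn from the finite sets
    of the blocks suffice. *)
Lemma product_finite_support (N : nat) (d : nat -> nat) (X : nat -> (nat -> R) -> Prop) :
  (forall i, (i < N)%nat -> finite_support (d i) (X i)) ->
  exists F : list (nat -> nat -> R),
    (forall t, In t F -> forall i, (i < N)%nat -> X i (t i)) /\
    forall h z, (forall i, (i < N)%nat -> conv (d i) (X i) (z i)) ->
      exists t, In t F /\ forall i, (i < N)%nat -> dot (d i) (h i) (t i) <= dot (d i) (h i) (z i).
Proof.
  induction N as [|N IH]; intros H.
  - exists [fun _ _ => 0]. split; [lia|]. intros h z _. eexists. split; [left; reflexivity|lia].
  - destruct IH as (F & HF1 & HF2); [intros; apply H; lia|].
    destruct (H N) as (F' & HF1' & HF2'); [lia|].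
    set (ext := fun (tp : (nat -> nat -> R) * (nat -> R)) i =>
      if (i =? N)%nat then snd tp else fst tp i).
    exists (map ext (list_prod F F')). split.
    + intros t Ht i Hi. apply in_map_iff in Ht as [[t' p] [<- Ht]].
      apply in_prod_iff in Ht as [Ht Hp]. unfold ext; simpl.
      destruct (Nat.eqb_spec i N) as [->|E]; [auto|apply HF1; auto; lia].
    + intros h z Hz.
      destruct (HF2 h z) as (t & Ht & Hle); [intros; apply Hz; lia|].
      destruct (conv_point_below (d N) (X N) (h N) (z N)) as (x & Hx & Hxz); [apply Hz; lia|].
      destruct (HF2' (h N) x Hx) as (p & Hp & Hpx).
      exists (ext (t, p)). split; [apply in_map, in_prod; auto|].
      intros i Hi. unfold ext; simpl.
      destruct (Nat.eqb_spec i N) as [->|E]; [lra|apply Hle; lia].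
Qed.

(* Linear programming duality over a product of convex hulls, extended by one ray [u >= 0]
   of cost [M] that relaxes the constraint [j] by [rho j * u]. *)
Lemma lagrange_multipliers (N : nat) (d : nat -> nat) (X : nat -> (nat -> R) -> Prop)
  (q : nat) (h : nat -> nat -> R) (gam : R) (G : nat -> nat -> nat -> R)
  (beta : nat -> R) (M : R) (rho : nat -> R) :
  (forall i, (i < N)%nat -> finite_support (d i) (X i)) -> 0 <= M ->
  (forall z u, (forall i, (i < N)%nat -> conv (d i) (X i) (z i)) -> 0 <= u ->
     (forall j, (j < q)%nat ->
        rsum N (fun i => dot (d i) (G j i) (z i)) <= beta j + rho j * u) ->
     gam <= rsum N (fun i => dot (d i) (h i) (z i)) + M * u) ->
  exists m, (forall j, (j < q)%nat -> 0 <= m j) /\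
    rsum q (fun j => m j * rho j) <= M /\
    forall z, (forall i, (i < N)%nat -> conv (d i) (X i) (z i)) ->
      gam <= rsum N (fun i => dot (d i) (h i) (z i)) +
        rsum q (fun j => m j * (rsum N (fun i => dot (d i) (G j i) (z i)) - beta j)).
Proof.
  intros Hsupp HM Himp.
  destruct (product_finite_support N d X Hsupp) as (F & HF1 & HF2).
  set (len := length F). set (tp := fun k => nth k F (fun _ _ => 0)).
  assert (Htp : forall k, (k < len)%nat -> forall i, (i < N)%nat -> X i (tp k i)).
  { intros k Hk. apply HF1. apply nth_In. exact Hk. }
  (* Indices [k < len] are the tuples of [F], shifted by [gam] and [beta]; index [len] is the ray
     [u]. *)
  set (f := fun k => if (k <? len)%nat
    then rsum N (fun i => dot (d i) (h i) (tp k i)) - gam else M).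
  set (g := fun k j => if (k <? len)%nat
    then rsum N (fun i => dot (d i) (G j i) (tp k i)) - beta j else - rho j).
  assert (Hlast : forall w a : nat -> R, forall b : R,
    rsum (S len) (fun k => w k * if (k <? len)%nat then a k else b) =
    rsum len (fun k => w k * a k) + w len * b).
  { intros w a b. simpl. rewrite Nat.ltb_irrefl. f_equal. apply rsum_ext. intros k Hk.
    apply Nat.ltb_lt in Hk. rewrite Hk. reflexivity. }
  destruct (farkas (S len) q f g) as (m & Hm & Hmk).
  { intros w Hw Hg. unfold f. rewrite Hlast.
    set (W := rsum len w).
    assert (HW : 0 <= W) by (apply rsum_nonneg; intros; apply Hw; lia).
    assert (Hwl : 0 <= w len) by (apply Hw; lia).
    (* If the tuples carry positive weight [W], dividing by it gives a point of the product of hulls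
       with [u = w len / W]; otherwise only the ray is left, and its cost is nonnegative. *)
    destruct (Rle_lt_or_eq_dec _ _ HW) as [HW1|HW0].
    - assert (HiW : 0 < / W) by (apply Rinv_0_lt_compat; auto).
      set (z := fun i k => rsum len (fun l => w l / W * tp l i k)).
      assert (Hcomb : forall a i, dot (d i) a (z i) = rsum len (fun l => w l / W * dot (d i) a (tp l i))).
      { intros a i. apply dot_comb. }
      assert (Hsum : forall (a : nat -> nat -> R) c,
        rsum len (fun k => w k * (rsum N (fun i => dot (d i) (a i) (tp k i)) - c)) =
        W * (rsum N (fun i => dot (d i) (a i) (z i)) - c)).
      { intros a c.
        rewrite (rsum_ext N _ _ (fun i _ => Hcomb (a i) i)), rsum_swap.
        rewrite (rsum_ext len (fun j => rsum N _)
                  (fun k => / W * (w k * rsum N (fun i => dot (d i) (a i) (tp k i))))).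
        2:{ intros k Hk. rewrite rsum_scal. unfold Rdiv. ring. }
        rewrite rsum_scal.
        rewrite (rsum_ext len _ (fun k => w k * rsum N (fun i => dot (d i) (a i) (tp k i)) - c * w k))
          by (intros; ring).
        rewrite rsum_minus, rsum_scal. fold W. field. lra. }
      rewrite Hsum.
      assert (Hgam : gam <= rsum N (fun i => dot (d i) (h i) (z i)) + M * (w len / W)).
      { apply Himp.
        - intros i Hi. exists len, (fun l => w l / W), (fun l => tp l i). repeat split.
          + apply Rmult_le_pos; [apply Hw; lia|lra].
          + apply Htp; auto.
          + unfold Rdiv. rewrite (rsum_ext len _ (fun l => / W * w l)) by (intros; ring).
            rewrite rsum_scal. fold W. apply Rinv_l. lra.
        - apply Rmult_le_pos; lra.
        - intros j Hj. specialize (Hg j Hj). unfold g in Hg. rewrite Hlast, Hsum in Hg.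
          apply Rmult_le_reg_l with W; [auto|].
          replace (W * (beta j + rho j * (w len / W))) with (W * beta j + w len * rho j)
            by (field; lra).
          lra. }
      apply Rmult_le_compat_l with (r := W) in Hgam; [|lra].
      replace (W * (rsum N (fun i => dot (d i) (h i) (z i)) + M * (w len / W))) with
        (W * rsum N (fun i => dot (d i) (h i) (z i)) + w len * M) in Hgam by (field; lra).
      lra.
    - rewrite rsum_zero.
      + rewrite Rplus_0_l. apply Rmult_le_pos; auto.
      + intros k Hk.
        assert (w k <= W).
        { apply (rsum_term_le len k w); [intros; apply Hw; lia|auto]. }
        assert (Hwk : 0 <= w k) by (apply Hw; lia).
        replace (w k) with 0 by lra. ring. }
  exists m. split; [auto|]. split.
  - specialize (Hmk len ltac:(lia)). unfold f, g in Hmk. rewrite Nat.ltb_irrefl in Hmk.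
    rewrite (rsum_ext q _ (fun j => -1 * (m j * rho j))), rsum_scal in Hmk by (intros; ring).
    lra.
  (* [H] is the gradient of the Lagrangian in [z]; finite support in direction [H] reduces the bound
     over the hulls to the tuples treated by Farkas' lemma. *)
  - set (H := fun i k => h i k + rsum q (fun j => m j * G j i k)).
    assert (HH : forall z, rsum N (fun i => dot (d i) (H i) (z i)) =
      rsum N (fun i => dot (d i) (h i) (z i)) +
      rsum q (fun j => m j * rsum N (fun i => dot (d i) (G j i) (z i)))).
    { intros z. unfold H.
      rewrite (rsum_ext N _ _ (fun i _ => dot_comb_l (d i) q (z i) (h i) m (fun j => G j i))).
      rewrite rsum_plus, rsum_swap. f_equal. apply rsum_ext. intros j _. apply rsum_scal. }
    assert (Hsplit : forall z, rsum q (fun j => m j * (rsum N (fun i => dot (d i) (G j i) (z i)) - beta j))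
      = rsum q (fun j => m j * rsum N (fun i => dot (d i) (G j i) (z i))) -
        rsum q (fun j => m j * beta j)).
    { intros z. rewrite <- rsum_minus. apply rsum_ext. intros; ring. }
    intros z Hz. destruct (HF2 H z Hz) as (t & Ht & Hle).
    destruct (In_nth F t (fun _ _ => 0) Ht) as (k & Hk & Ek).
    specialize (Hmk k (Nat.lt_lt_succ_r _ _ Hk)). unfold f, g in Hmk.
    assert (Hlt := proj2 (Nat.ltb_lt k len) Hk). rewrite Hlt in Hmk.
    change (nth k F (fun _ _ => 0)) with (tp k) in Ek. rewrite Ek in Hmk.
    rewrite Hsplit in Hmk |- *.
    apply rsum_le in Hle. rewrite !HH in Hle. lra.
Qed.

(** * Local and coupled linear programs *)

(** Isolates the coefficient of [v], whose sign decides whether the Lagrangian is bounded below in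
    [v >= 0]. *)
Lemma loc_lag_split (P : milp_data) (i : nat) (M : R) (y mu z : nat -> R) (v : R) :
  loc_lag P i M y mu z v =
  dot (dim P i) (cost P i) z + rsum (ncons P) (fun s => mu s * (Arow P i s z - y s)) +
  (M - rsum (ncons P) mu) * v.
Proof.
  unfold loc_lag, loc_obj.
  rewrite (rsum_ext _ (fun s => mu s * (Arow P i s z - y s - v))
             (fun s => mu s * (Arow P i s z - y s) - v * mu s)) by (intros; ring).
  rewrite rsum_minus, rsum_scal. ring.
Qed.

Section LocalProblem.
Variables (P : milp_data) (i : nat) (M : R) (y z : nat -> R) (v : R) (mu : nat -> R).
Hypothesis hsupp : finite_support (dim P i) (inX P i).
Hypothesis hM : 0 < M.
Hypothesis hopt : primal_dual_opt P i M y z v mu.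

(** The multipliers [m] from linear programming duality make the primal value a lower bound of the
    Lagrangian, and the dual optimal [mu] inherits every such bound. The variable [v] is the ray of
    cost [M] that relaxes each constraint by one unit. *)
Lemma strong_duality (z' : nat -> R) (v' : R) :
  inconv P i z' -> 0 <= v' -> loc_obj P i M z v <= loc_lag P i M y mu z' v'.
Proof.
  destruct hopt as [[_ Hmin] [_ Hdual]].
  destruct (lagrange_multipliers 1 (fun _ => dim P i) (fun _ => inX P i) (ncons P)
     (fun _ => cost P i) (loc_obj P i M z v) (fun s _ => Amat P i s) y M (fun _ => 1))
    as (m & Hm & HmM & Hlag).
  - auto.
  - lra.
  - intros z0 u Hz0 Hu Hs. simpl. rewrite Rplus_0_l. apply Hmin. split; [|split].
    + apply (Hz0 0%nat). lia.
    + auto.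
    + intros s Hs'. specialize (Hs s Hs'). simpl in Hs. unfold Arow. lra.
  - apply (Hdual m Hm). intros z0 v0 Hz0 Hv0. rewrite loc_lag_split.
    specialize (Hlag (fun _ => z0) (fun _ _ => Hz0)). simpl in Hlag.
    rewrite (rsum_ext _ (fun j => m j * (0 + _ - y j))
               (fun s => m s * (Arow P i s z0 - y s))) in Hlag
      by (intros; unfold Arow; ring).
    rewrite (rsum_ext _ _ m) in HmM by (intros; ring).
    assert (0 <= (M - rsum (ncons P) m) * v0) by (apply Rmult_le_pos; lra).
    lra.
Qed.

(** Otherwise a large [v] would drive the Lagrangian below the primal value. *)
Lemma multiplier_sum_le : rsum (ncons P) mu <= M.
Proof.
  apply Rnot_lt_le. intros Hlt.
  assert (Hz : inconv P i z) by apply hopt.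
  set (K := dot (dim P i) (cost P i) z + rsum (ncons P) (fun s => mu s * (Arow P i s z - y s))).
  set (p := loc_obj P i M z v).
  set (v' := (Rabs K + Rabs p + 1) / (rsum (ncons P) mu - M)).
  pose proof (Rabs_pos K) as HK. pose proof (Rabs_pos p) as Hp.
  assert (Hv' : 0 <= v').
  { unfold v'. apply Rmult_le_pos; [lra|]. left. apply Rinv_0_lt_compat. lra. }
  pose proof (strong_duality z v' Hz Hv') as H.
  rewrite loc_lag_split in H. fold K p in H.
  replace ((M - rsum (ncons P) mu) * v') with (- (Rabs K + Rabs p + 1)) in H
    by (unfold v'; field; lra).
  pose proof (Rle_abs K). pose proof (Rle_abs (- p)). rewrite Rabs_Ropp in *. lra.
Qed.

Lemma multiplier_bounds (s : nat) : (s < ncons P)%nat -> 0 <= mu s <= M.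
Proof.
  intros Hs. assert (Hpos := proj1 (proj2 hopt)). split; [auto|].
  apply Rle_trans with (rsum (ncons P) mu); [apply rsum_term_le; auto|].
  apply multiplier_sum_le.
Qed.

(** Says that [- mu] is a subgradient at [y] of the local value as a function of the allocation. It
    is applied with the reference optimum and with the preceding iterate as the feasible pair. *)
Lemma local_value_subgradient (y' z' : nat -> R) (v' : R) :
  loc_feas P i y' z' v' ->
  loc_obj P i M z v <=
    loc_obj P i M z' v' + rsum (ncons P) (fun s => mu s * (y' s - y s)).
Proof.
  intros (Hz' & Hv' & Hs).
  apply Rle_trans with (1 := strong_duality z' v' Hz' Hv').
  unfold loc_lag. apply Rplus_le_compat_l, rsum_le. intros s Hs'.
  specialize (Hs s Hs'). apply Rmult_le_compat_l; [apply multiplier_bounds; auto|lra].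
Qed.

End LocalProblem.

Section CoupledProblem.
Variables (P : milp_data) (rr : R) (zs : nat -> nat -> R).
Hypothesis hsupp : forall i, (i < nag P)%nat -> finite_support (dim P i) (inX P i).
Hypothesis hopt : lpr_opt P rr zs.

(** Shadow prices: relaxing every coupling constraint by [w] lowers the optimal cost by at most [w]
    times the sum of the multipliers. *)
Lemma exact_penalty : exists m0, 0 <= m0 /\
  forall z w, (forall i, (i < nag P)%nat -> inconv P i (z i)) -> 0 <= w ->
    (forall s, (s < ncons P)%nat ->
       rsum (nag P) (fun i => Arow P i s (z i)) <= bvec P s - rr + w) ->
    total_cost P zs <= total_cost P z + m0 * w.
Proof.
  destruct (lagrange_multipliers (nag P) (dim P) (inX P) (ncons P) (cost P)
     (total_cost P zs) (fun s i => Amat P i s) (fun s => bvec P s - rr) 0 (fun _ => 0))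
    as (m & Hm & _ & Hlag); [auto|lra| |].
  - intros z u Hz Hu Hs.
    apply Rle_trans with (total_cost P z); [|unfold total_cost; lra].
    apply hopt. split; [auto|]. intros s Hs'. specialize (Hs s Hs'). simpl in Hs.
    unfold Arow. lra.
  - exists (rsum (ncons P) m). split; [apply rsum_nonneg; auto|].
    intros z w Hz Hw Hs. specialize (Hlag z Hz).
    eapply Rle_trans; [apply Hlag|]. apply Rplus_le_compat_l.
    rewrite Rmult_comm, <- rsum_scal. apply rsum_le. intros s Hs'.
    rewrite Rmult_comm. apply Rmult_le_compat_r; [auto|].
    specialize (Hs s Hs'). unfold Arow in Hs. lra.
Qed.

Hypothesis huniq : forall z, lpr_opt P rr z ->
  forall i k, (i < nag P)%nat -> (k < dim P i)%nat -> z i k = zs i k.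

(* Uniqueness makes [A_i^s z_i >= A_i^s zs_i] a consequence of near-optimality, and linear
   programming duality turns this consequence into a linear error bound. *)
Lemma sharp_optimum : exists K, 0 <= K /\
  forall z w, (forall i, (i < nag P)%nat -> inconv P i (z i)) -> 0 <= w ->
    (forall s, (s < ncons P)%nat ->
       rsum (nag P) (fun i => Arow P i s (z i)) <= bvec P s - rr + w) ->
    total_cost P z <= total_cost P zs + w ->
    forall i s, (i < nag P)%nat -> (s < ncons P)%nat ->
      Arow P i s (zs i) <= Arow P i s (z i) + K * w.
Proof.
  set (Bd := fun i s K => forall z w, (forall i, (i < nag P)%nat -> inconv P i (z i)) -> 0 <= w ->
    (forall s, (s < ncons P)%nat ->
       rsum (nag P) (fun i => Arow P i s (z i)) <= bvec P s - rr + w) ->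
    total_cost P z <= total_cost P zs + w ->
    Arow P i s (zs i) <= Arow P i s (z i) + K * w).
  assert (Hmon : forall i s a b, a <= b -> Bd i s a -> Bd i s b).
  { intros i s a b Hab Ha z w Hz Hw Hs Hc. specialize (Ha z w Hz Hw Hs Hc). nra. }
  destruct (finite_bound (fun i K => forall s, (s < ncons P)%nat -> Bd i s K) (nag P))
    as (K & HK & HB).
  { intros i a b Hab Ha s Hs. eauto. }
  2:{ exists K. split; [auto|]. intros z w Hz Hw Hs Hc i s Hi Hs'. apply (HB i Hi s Hs'); auto. }
  intros i0 Hi0.
  destruct (finite_bound (fun s K => Bd i0 s K) (ncons P)) as (K & _ & HK);
    [intros; eauto| |exists K; auto].
  intros s0 Hs0.
  (* Row [ncons P] is the cost bound, appended to the coupling constraints; [h] extracts block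
     [i0]. *)
  set (G := fun j i => if (j =? ncons P)%nat then cost P i else Amat P i j).
  set (beta := fun j => if (j =? ncons P)%nat then total_cost P zs else bvec P j - rr).
  set (h := fun (i k : nat) => (if (i =? i0)%nat then 1 else 0) * Amat P i0 s0 k).
  assert (Hh : forall z, rsum (nag P) (fun i => dot (dim P i) (h i) (z i)) = Arow P i0 s0 (z i0)).
  { intros z. unfold Arow.
    rewrite <- (rsum_single (nag P) i0 (fun i => dot (dim P i) (Amat P i0 s0) (z i)) Hi0).
    apply rsum_ext. intros i _. unfold h, dot. destruct (i =? i0)%nat.
    - apply rsum_ext. intros; ring.
    - apply rsum_zero. intros; ring. }
  assert (HG : forall (z : nat -> nat -> R) (c : nat -> R),
    (forall s, (s < ncons P)%nat -> rsum (nag P) (fun i => Arow P i s (z i)) <= bvec P s - rr + c s) ->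
    total_cost P z <= total_cost P zs + c (ncons P) ->
    forall j, (j < S (ncons P))%nat ->
      rsum (nag P) (fun i => dot (dim P i) (G j i) (z i)) - beta j <= c j).
  { intros z c H1 H2 j Hj. unfold G, beta.
    destruct (Nat.eqb_spec j (ncons P)) as [->|E].
    - unfold total_cost in *. lra.
    - specialize (H1 j ltac:(lia)). unfold Arow in H1. lra. }
  destruct (lagrange_multipliers (nag P) (dim P) (inX P) (S (ncons P)) h
     (Arow P i0 s0 (zs i0)) G beta 0 (fun _ => 0))
    as (m & Hm & _ & Hlag); [auto|lra| |].
  - intros z u Hz Hu Hs. rewrite Hh.
    (* A point satisfying all rows without relaxation is optimal, hence equal to [zs] by
       uniqueness. *)
    assert (Hopt : lpr_opt P rr z).
    { assert (Hc : total_cost P z <= total_cost P zs).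
      { specialize (Hs (ncons P) ltac:(lia)). unfold G, beta in Hs.
        rewrite Nat.eqb_refl in Hs. unfold total_cost at 1. lra. }
      split; [split; [auto|]|].
      - intros s Hs'. specialize (Hs s ltac:(lia)). unfold G, beta in Hs.
        destruct (Nat.eqb_spec s (ncons P)); [lia|]. unfold Arow. lra.
      - intros z' Hz'. apply Rle_trans with (1 := Hc). apply hopt, Hz'. }
    unfold Arow. rewrite (dot_ext _ _ (zs i0) (z i0)); [lra|].
    intros k Hk. symmetry. apply huniq; auto.
  - exists (rsum (S (ncons P)) m). intros z w Hz Hw Hs Hc.
    specialize (Hlag z Hz). rewrite Hh in Hlag.
    eapply Rle_trans; [apply Hlag|]. apply Rplus_le_compat_l.
    rewrite Rmult_comm, <- rsum_scal. apply rsum_le. intros j Hj.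
    rewrite Rmult_comm. apply Rmult_le_compat_r; [auto|].
    apply (HG z (fun _ => w)); auto.
Qed.

End CoupledProblem.

(** * Few agents have a fractional optimal block *)

Lemma conv_ext (d : nat) (X : (nat -> R) -> Prop) (z z' : nat -> R) :
  (forall k, (k < d)%nat -> z' k = z k) -> conv d X z -> conv d X z'.
Proof.
  intros H (m & lam & pts & H1 & H2 & H3). exists m, lam, pts. repeat split; try apply H1; auto.
  intros k Hk. rewrite H; auto.
Qed.

(** Shifting weight towards or away from a point of positive weight stays in the hull, and the
    direction is nonzero because [z] agrees with no point of [X]. *)
Lemma conv_not_extreme (d : nat) (X : (nat -> R) -> Prop) (z : nat -> R) :
  conv d X z -> ~ (exists x, X x /\ forall k, (k < d)%nat -> z k = x k) ->
  exists dir, (exists k, (k < d)%nat /\ dir k <> 0) /\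
    forall tau, Rabs tau <= 1 -> conv d X (fun k => z k + tau * dir k).
Proof.
  intros (m & lam & pts & Hpts & Hsum & Hz) Hno.
  destruct (classic (exists j, (j < m)%nat /\ lam j <> 0)) as [(j & Hj & Hlj)|H0].
  2:{ exfalso. rewrite rsum_zero in Hsum; [lra|]. intros k Hk. apply NNPP. intros E.
      apply H0. eauto. }
  destruct (Hpts j Hj) as [Hlj0 HXj].
  assert (Hlj1 : lam j <= 1).
  { rewrite <- Hsum. apply rsum_term_le; [intros; apply Hpts|]; auto. }
  (* The factor [lam j] keeps the shifted weights nonnegative for all [tau] between -1 and 1. *)
  exists (fun k => lam j * (pts j k - z k)). split.
  - apply NNPP. intros E. apply Hno. exists (pts j). split; [auto|].
    intros k Hk. apply NNPP. intros E'. apply E. exists k. split; [auto|].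
    apply Rmult_integral_contrapositive. split; [auto|lra].
  - intros tau Htau. assert (Htau' : -1 <= tau <= 1) by (revert Htau; unfold Rabs; destruct (Rcase_abs tau); lra). set (th := tau * lam j).
    assert (Hth : - lam j <= th <= lam j) by (unfold th; nra).
    exists m, (fun l => (1 - th) * lam l + (if (l =? j)%nat then th else 0)), pts. repeat split.
    + destruct (Hpts j0 H) as [Hl _]. destruct (Nat.eqb_spec j0 j) as [->|_]; nra.
    + apply Hpts; auto.
    + rewrite rsum_plus, rsum_scal, Hsum, rsum_single by auto. ring.
    + intros k Hk.
      rewrite (rsum_ext m _ (fun l => (1 - th) * (lam l * pts l k) +
                 (if (l =? j)%nat then th * pts l k else 0)))
        by (intros l _; destruct (l =? j)%nat; ring).
      rewrite rsum_plus, rsum_scal, rsum_single, <- Hz by auto. unfold th. ring.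
Qed.

(** With more than [ncons P] fractional blocks, the images of their free directions under the
    matrices are linearly dependent. Moving [zs] along the dependence preserves the coupling sums,
    and since both orientations are feasible the cost is unchanged, against uniqueness. *)
Lemma few_fractional (P : milp_data) (rr : R) (zs : nat -> nat -> R) (frac : nat -> bool) :
  lpr_opt P rr zs ->
  (forall z, lpr_opt P rr z ->
     forall i k, (i < nag P)%nat -> (k < dim P i)%nat -> z i k = zs i k) ->
  (forall i, (i < nag P)%nat -> frac i = true ->
     ~ exists x, inX P i x /\ forall k, (k < dim P i)%nat -> zs i k = x k) ->
  (count (nag P) frac <= ncons P)%nat.
Proof.
  intros [[Hconv Hcons] Hmin] Huniq Hfrac. apply Nat.nlt_ge. intros Hlt.
  destruct (finite_choice (nat -> R) (fun _ => 0) (fun i dir =>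
     (frac i = true -> exists k, (k < dim P i)%nat /\ dir k <> 0) /\
     forall tau, Rabs tau <= 1 -> inconv P i (fun k => zs i k + tau * dir k)) (nag P))
    as [dir Hdir].
  { intros i Hi. destruct (frac i) eqn:E.
    - destruct (conv_not_extreme (dim P i) (inX P i) (zs i)) as (dir & H1 & H2);
        [apply Hconv; auto|apply Hfrac; auto|]. exists dir. auto.
    - exists (fun _ => 0). split; [discriminate|]. intros tau _.
      apply conv_ext with (zs i); [intros; ring|apply Hconv; auto]. }
  destruct (linear_dependence (nag P) (ncons P) frac (fun i s => Arow P i s (dir i)) Hlt)
    as (th & (i1 & Hi1 & Hth1) & Hsupp & Hth).
  (* Dividing by [T] keeps each block within the unit range of its direction. *)
  set (T := rsum (nag P) (fun i => Rabs (th i))).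
  assert (HT : forall i, (i < nag P)%nat -> Rabs (th i) <= T).
  { intros i Hi. apply (rsum_term_le _ i (fun i => Rabs (th i))); [intros; apply Rabs_pos|auto]. }
  assert (HT0 : 0 < T).
  { apply Rlt_le_trans with (2 := HT i1 Hi1). apply Rabs_pos_lt; auto. }
  set (mv := fun (e : R) i k => zs i k + (e * (th i / T)) * dir i k).
  set (slope := rsum (nag P) (fun i => th i / T * dot (dim P i) (cost P i) (dir i))).
  assert (Hfeas : forall e, Rabs e <= 1 -> lpr_feas P rr (mv e)).
  { intros e He. split.
    - intros i Hi. apply (Hdir i Hi). specialize (HT i Hi).
      rewrite Rabs_mult. unfold Rdiv. rewrite Rabs_mult, (Rabs_pos_eq (/ T))
        by (left; apply Rinv_0_lt_compat; auto).
      assert (Hle : Rabs (th i) * / T <= 1).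
      { apply Rmult_le_reg_r with T; [auto|].
        rewrite Rmult_assoc, Rinv_l by lra. lra. }
      pose proof (Rabs_pos e).
      apply Rle_trans with (Rabs e * 1); [apply Rmult_le_compat_l|]; lra.
    - intros s Hs. apply Rle_trans with (2 := Hcons s Hs). right. unfold mv, Arow.
      rewrite (rsum_ext _ _ (fun i => dot (dim P i) (Amat P i s) (zs i) +
         e / T * (th i * dot (dim P i) (Amat P i s) (dir i)))).
      2:{ intros i _. rewrite dot_line. unfold Rdiv. ring. }
      rewrite rsum_plus, rsum_scal. unfold Arow in Hth. rewrite (Hth s Hs). ring. }
  assert (Hcost : forall e, total_cost P (mv e) = total_cost P zs + e * slope).
  { intros e. unfold total_cost, slope. rewrite <- rsum_scal, <- rsum_plus.
    apply rsum_ext. intros i _. unfold mv. rewrite dot_line. ring. }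
  assert (H1 : Rabs 1 <= 1) by (rewrite Rabs_R1; lra).
  assert (H1' : Rabs (-1) <= 1) by (rewrite Rabs_left; lra).
  assert (Hup := Hmin _ (Hfeas 1 H1)). assert (Hdn := Hmin _ (Hfeas (-1) H1')).
  rewrite Hcost in Hup, Hdn.
  assert (Hopt : lpr_opt P rr (mv 1)).
  { split; [auto|]. intros z' Hz'. rewrite Hcost. specialize (Hmin z' Hz'). lra. }
  assert (Hf1 : frac i1 = true).
  { destruct (frac i1) eqn:E; [auto|]. exfalso. apply Hth1. auto. }
  destruct (proj1 (Hdir i1 Hi1) Hf1) as (k & Hk & Hdk).
  specialize (Huniq _ Hopt i1 k Hi1 Hk). unfold mv in Huniq.
  assert (E : th i1 * dir i1 k = 0).
  { replace (th i1 * dir i1 k) with (T * (1 * (th i1 / T) * dir i1 k)) by (field; lra).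
    replace (1 * (th i1 / T) * dir i1 k) with 0 by lra. ring. }
  apply Rmult_integral in E. tauto.
Qed.

(** * Feasibility of the rounded points *)

Lemma rmaxn_nonneg (n : nat) (f : nat -> R) : 0 <= rmaxn n f.
Proof.
  induction n as [|n IH]; simpl; [lra|].
  apply Rle_trans with (1 := IH), Rmax_l.
Qed.

Lemma rmaxn_ge (n i : nat) (f : nat -> R) : (i < n)%nat -> f i <= rmaxn n f.
Proof.
  induction n as [|n IH]; intros Hi; [lia|]. simpl.
  destruct (Nat.eq_dec i n) as [->|E]; [apply Rmax_r|].
  apply Rle_trans with (rmaxn n f); [apply IH; lia|apply Rmax_l].
Qed.

(** By minimality of [rho], each block of [x] violates its allocation no more than a competitor in
    [X_i] allows: the block of [zs] itself if it lies in [X_i], and [xL i] otherwise. *)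
Lemma rounding_feasible (P : milp_data) (L xL : nat -> nat -> R) (ltil : nat -> R)
  (delta eps : R) (zs y x : nat -> nat -> R) :
  is_Lmin P L -> is_xL_opt P L xL ltil ->
  lpr_opt P (sigma_asy P L xL + delta) zs ->
  (forall z, lpr_opt P (sigma_asy P L xL + delta) z ->
     forall i k, (i < nag P)%nat -> (k < dim P i)%nat -> z i k = zs i k) ->
  0 <= eps -> INR (nag P) * eps <= delta ->
  (forall s, (s < ncons P)%nat ->
     rsum (nag P) (fun i => y i s) = bvec P s - (sigma_asy P L xL + delta)) ->
  (forall i s, (i < nag P)%nat -> (s < ncons P)%nat -> Arow P i s (zs i) <= y i s + eps) ->
  (forall i, (i < nag P)%nat -> exists rho xi, p3_lexopt P i (y i) (x i) rho xi) ->
  milp_feasible_pt P x.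
Proof.
  intros HL HxL Hopt Huniq Heps Hdelta Hy Hzs Hx.
  destruct (finite_choice bool true (fun i b => b = true <->
      ~ exists x, inX P i x /\ forall k, (k < dim P i)%nat -> zs i k = x k) (nag P))
    as [frac Hfrac].
  { intros i _. destruct (classic (exists x, inX P i x /\ forall k, (k < dim P i)%nat -> zs i k = x k)).
    - exists false. split; [discriminate|tauto].
    - exists true. tauto. }
  set (c := rmaxn (nag P) (fun i => rmaxn (ncons P) (fun s => Arow P i s (xL i) - L i s))).
  assert (Hc0 : 0 <= c) by apply rmaxn_nonneg.
  assert (Hc : forall i s, (i < nag P)%nat -> (s < ncons P)%nat -> Arow P i s (xL i) - L i s <= c).
  { intros i s Hi Hs.
    apply Rle_trans with (rmaxn (ncons P) (fun s => Arow P i s (xL i) - L i s)).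
    - apply (rmaxn_ge _ s (fun s => Arow P i s (xL i) - L i s)); auto.
    - apply (rmaxn_ge _ i (fun i => rmaxn (ncons P) (fun s => Arow P i s (xL i) - L i s))); auto. }
  assert (Hlex : forall i x' rho', (i < nag P)%nat -> inX P i x' -> 0 <= rho' ->
    (forall s, (s < ncons P)%nat -> Arow P i s x' <= y i s + rho') ->
    forall s, (s < ncons P)%nat -> Arow P i s (x i) <= y i s + rho').
  { intros i x' rho' Hi HX Hr Hs s Hs'.
    destruct (Hx i Hi) as (rho & xi & (_ & _ & _ & HA) & Hbest).
    specialize (HA s Hs').
    destruct (Hbest x' rho' (dot (dim P i) (cost P i) x')) as [H|[H _]].
    - repeat split; try apply HX; auto; lra.
    - lra.
    - lra. }
  split.
  { intros i Hi. destruct (Hx i Hi) as (rho & xi & (H & _) & _). exact H. }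
  intros s Hs.
  apply Rle_trans with (rsum (nag P) (fun i => y i s + if frac i then eps + c else eps)).
  - apply rsum_le. intros i Hi. destruct (frac i) eqn:E.
    (* [L i] bounds the rows from below on the hull too, so [xL i] exceeds [zs i] by at most [c] in
       every row. *)
    + apply (Hlex i (xL i)); auto; [apply HxL; auto|lra|].
      intros s' Hs'. specialize (Hc i s' Hi Hs'). specialize (Hzs i s' Hi Hs').
      destruct (conv_point_below (dim P i) (inX P i) (Amat P i s') (zs i)) as (x' & Hx' & Hle).
      { apply Hopt; auto. }
      assert (HLx := proj2 (HL i s' Hi Hs') x' Hx'). unfold Arow in *. lra.
    + destruct (classic (exists x, inX P i x /\ forall k, (k < dim P i)%nat -> zs i k = x k))
        as [(x' & Hx' & Heq)|H].
      * apply (Hlex i x'); auto. intros s' Hs'. specialize (Hzs i s' Hi Hs').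
        unfold Arow in *. rewrite <- (dot_ext _ _ _ _ Heq). exact Hzs.
      * apply (Hfrac i Hi) in H. congruence.
  (* The restriction pays: [sigma_asy] covers the extra [c] of at most [ncons P] blocks, and [delta]
     covers the [eps] terms. *)
  - rewrite rsum_plus, rsum_count, (Hy s Hs). unfold sigma_asy. fold c.
    assert (Hcnt : INR (count (nag P) frac) <= INR (ncons P + 1)).
    { apply le_INR.
      enough (count (nag P) frac <= ncons P)%nat by lia.
      apply few_fractional with (1 := Hopt); auto.
      intros i Hi. apply Hfrac; auto. }
    apply Rmult_le_compat_r with (r := c) in Hcnt; auto. lra.
Qed.

(** * Flows on the communication graph *)

(** For antisymmetric [E] this is the divergence of an edge flow at node [i]. *)
Definition net (N : nat) (adj : nat -> nat -> bool) (E : nat -> nat -> R) (i : nat) : R :=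
  rsum N (fun j => if adj i j then E i j else 0).

Lemma net_plus_scal (N : nat) (adj : nat -> nat -> bool) (E E' : nat -> nat -> R) (c : R) (i : nat) :
  net N adj (fun i j => E i j + c * E' i j) i = net N adj E i + c * net N adj E' i.
Proof.
  unfold net. rewrite <- rsum_scal, <- rsum_plus. apply rsum_ext.
  intros j _. destruct (adj i j); ring.
Qed.

(** Induction on the path: an edge carries one unit directly, and the flows of concatenated paths
    add up. *)
Lemma unit_flow (N : nat) (adj : nat -> nat -> bool) (u w : nat) :
  graph_ok N adj -> clos_refl_trans nat (fun u w => adj u w = true) u w ->
  exists E, (forall i j, E i j = - E j i) /\
    forall i, net N adj E i = (if (i =? u)%nat then 1 else 0) - (if (i =? w)%nat then 1 else 0).
Proof.
  intros (Hin & Hsym & Hirr & _) H. induction H as [u w Huw|u|u w x _ (E & HE & Hn) _ (E' & HE' & Hn')].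
  - exists (fun i j => (if (i =? u)%nat then if (j =? w)%nat then 1 else 0 else 0) -
                       (if (j =? u)%nat then if (i =? w)%nat then 1 else 0 else 0)).
    split; [intros; ring|]. intros i. unfold net.
    assert (Huw' : u <> w) by (intros ->; congruence).
    assert (Hwu : adj w u = true) by (rewrite Hsym; auto).
    destruct (Hin u w Huw) as [Hu Hw].
    rewrite (rsum_ext N _ (fun j =>
      (if (j =? w)%nat then if (i =? u)%nat then 1 else 0 else 0) -
      (if (j =? u)%nat then if (i =? w)%nat then 1 else 0 else 0))).
    + rewrite rsum_minus.
      rewrite (rsum_single N w (fun _ => if (i =? u)%nat then 1 else 0) Hw).
      rewrite (rsum_single N u (fun _ => if (i =? w)%nat then 1 else 0) Hu). reflexivity.
    + intros j _. destruct (adj i j) eqn:E.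
      * destruct (i =? u)%nat, (j =? w)%nat; reflexivity.
      * destruct (Nat.eqb_spec i u), (Nat.eqb_spec j w), (Nat.eqb_spec j u), (Nat.eqb_spec i w);
          try (subst; congruence); ring.
  - exists (fun _ _ => 0). split; [intros; ring|]. intros i. unfold net.
    rewrite rsum_zero; [ring|]. intros j _. destruct (adj i j); reflexivity.
  - exists (fun i j => E i j + 1 * E' i j). split.
    + intros i j. rewrite HE, HE'. ring.
    + intros i. rewrite net_plus_scal, Hn, Hn'. ring.
Qed.

(** Every node [u] sends [D u s] to node 0 along a path; the balance at node 0 is right because [D]
    sums to zero. *)
Lemma flow_exists (N : nat) (adj : nat -> nat -> bool) (D : nat -> nat -> R) (q : nat) :
  graph_ok N adj -> (forall s, (s < q)%nat -> rsum N (fun i => D i s) = 0) ->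
  exists F : nat -> nat -> nat -> R, (forall s i j, F s i j = - F s j i) /\
    forall i s, (i < N)%nat -> (s < q)%nat -> net N adj (F s) i = D i s.
Proof.
  intros HG HD.
  assert (H : forall n, (n <= N)%nat -> exists F : nat -> nat -> nat -> R,
    (forall s i j, F s i j = - F s j i) /\
    forall i s, net N adj (F s) i =
      rsum n (fun u => D u s * ((if (i =? u)%nat then 1 else 0) - (if (i =? 0)%nat then 1 else 0)))).
  { induction n as [|n IH]; intros Hn.
    - exists (fun _ _ _ => 0). split; [intros; ring|]. intros i s. unfold net.
      rewrite rsum_zero; [reflexivity|]. intros j _. destruct (adj i j); reflexivity.
    - destruct IH as (F & HF1 & HF2); [lia|].
      destruct (unit_flow N adj n 0 HG) as (E & HE1 & HE2); [apply HG; lia|].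
      exists (fun s i j => F s i j + D n s * E i j). split.
      + intros s i j. rewrite HF1, HE1. ring.
      + intros i s. rewrite net_plus_scal, HF2, HE2. reflexivity. }
  destruct (H N (le_n N)) as (F & HF1 & HF2). exists F. split; [auto|].
  intros i s Hi Hs. rewrite HF2.
  rewrite (rsum_ext N _ (fun u => (if (u =? i)%nat then D u s else 0) -
     (if (i =? 0)%nat then 1 else 0) * D u s)).
  - rewrite rsum_minus, rsum_scal, (rsum_single N i (fun u => D u s)), HD by auto. ring.
  - intros u _. rewrite Nat.eqb_sym. destruct (u =? i)%nat; ring.
Qed.

(** Summation by parts on the graph; the factor 2 comes from counting each edge in both
    orientations. *)
Lemma antisymmetric_sum (N : nat) (adj : nat -> nat -> bool) (E : nat -> nat -> R) (mu : nat -> R) :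
  (forall i j, adj i j = adj j i) -> (forall i j, E i j = - E j i) ->
  rsum N (fun i => rsum N (fun j => if adj i j then E i j * (mu i - mu j) else 0)) =
  2 * rsum N (fun i => mu i * net N adj E i).
Proof.
  intros Hadj HE.
  rewrite (rsum_ext N _ (fun i => mu i * net N adj E i -
     rsum N (fun j => if adj i j then E i j * mu j else 0))).
  2:{ intros i _. unfold net. rewrite <- rsum_scal, <- rsum_minus. apply rsum_ext.
      intros j _. destruct (adj i j); ring. }
  rewrite rsum_minus, rsum_swap.
  rewrite (rsum_ext N (fun j => rsum N _) (fun i => -1 * (mu i * net N adj E i))).
  2:{ intros i _. unfold net. rewrite <- !rsum_scal. apply rsum_ext.
      intros j _. rewrite (HE j i), (Hadj j i). destruct (adj i j); ring. }
  rewrite rsum_scal. ring.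
Qed.

Lemma antisymmetric_net_zero (N : nat) (adj : nat -> nat -> bool) (E : nat -> nat -> R) :
  (forall i j, adj i j = adj j i) -> (forall i j, E i j = - E j i) ->
  rsum N (net N adj E) = 0.
Proof.
  intros Hadj HE. pose proof (antisymmetric_sum N adj E (fun _ => 1) Hadj HE) as H.
  rewrite rsum_zero in H.
  - rewrite (rsum_ext N (fun i => 1 * net N adj E i) (net N adj E)) in H by (intros; ring). lra.
  - intros i _. apply rsum_zero. intros j _. destruct (adj i j); ring.
Qed.

(** Expand the square: summation by parts evaluates the cross term, and [M ^ 2] bounds each squared
    multiplier difference. *)
Lemma flow_energy_step (N : nat) (adj : nat -> nat -> bool) (E : nat -> nat -> R) (mu : nat -> R)
  (a M : R) :
  (forall i j, adj i j = adj j i) -> (forall i j, E i j = - E j i) ->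
  (forall i, (i < N)%nat -> 0 <= mu i <= M) ->
  rsum N (fun i => rsum N (fun j => if adj i j then (E i j + a * (mu i - mu j)) ^ 2 else 0)) <=
  rsum N (fun i => rsum N (fun j => if adj i j then E i j ^ 2 else 0)) +
  4 * a * rsum N (fun i => mu i * net N adj E i) + INR N * (INR N * M ^ 2) * a ^ 2.
Proof.
  intros Hadj HE Hmu.
  replace (4 * a * rsum N (fun i => mu i * net N adj E i)) with
    (2 * a * (2 * rsum N (fun i => mu i * net N adj E i))) by ring.
  rewrite <- (antisymmetric_sum N adj E mu Hadj HE).
  replace (INR N * (INR N * M ^ 2) * a ^ 2) with
    (rsum N (fun _ => rsum N (fun _ => M ^ 2 * a ^ 2))) by (rewrite !rsum_const; ring).
  rewrite <- rsum_scal, <- !rsum_plus. apply rsum_le. intros i Hi.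
  rewrite <- rsum_scal, <- !rsum_plus. apply rsum_le. intros j Hj.
  specialize (Hmu i Hi) as H1. specialize (Hmu j Hj) as H2.
  assert (H : (mu i - mu j) ^ 2 <= M ^ 2) by nra.
  pose proof (pow2_ge_0 a) as Ha. pose proof (pow2_ge_0 M) as HM.
  destruct (adj i j); nra.
Qed.

(** * Convergence of the subgradient method *)

Lemma sum_f_R0_rsum (f : nat -> R) (n : nat) : sum_f_R0 f n = rsum (S n) f.
Proof. induction n as [|n IH]; simpl in *; [ring|]. rewrite IH. reflexivity. Qed.

Lemma bounded_nonneg_series_tail (f : nat -> R) (B : R) :
  (forall t, 0 <= f t) -> (forall t, rsum t f <= B) ->
  forall eps, 0 < eps -> exists T, forall t, (T <= t)%nat -> rsum t f <= rsum T f + eps.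
Proof.
  intros Hf HB eps Heps.
  destruct (completeness (fun x => exists t, x = rsum t f)) as [l [Hub Hlub]].
  - exists B. intros x [t ->]. auto.
  - exists (rsum 0 f), O. reflexivity.
  - destruct (classic (exists T, l - eps < rsum T f)) as [[T HT]|H].
    + exists T. intros t _. specialize (Hub _ (ex_intro _ t eq_refl)). lra.
    + exfalso. assert (l <= l - eps); [|lra]. apply Hlub. intros x [t ->].
      apply Rnot_lt_le. intros Hlt. apply H. eauto.
Qed.

(* Once the remaining weighted sum is small and the error is below [eps/4], an excursion of
   the error above [eps] would have to spend step-length on the region above [eps/4], which
   the remaining sum forbids. *)
Lemma error_vanishes (alpha e : nat -> R) (C B : R) :
  0 <= C -> (forall t, 0 <= alpha t) -> cv_infty (fun T => sum_f_R0 alpha T) ->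
  (forall eps, 0 < eps -> exists T, forall t, (T <= t)%nat -> alpha t <= eps) ->
  (forall t, 0 <= e t) -> (forall t, e (S t) <= e t + C * alpha t) ->
  (forall t, rsum t (fun k => alpha k * e k) <= B) ->
  forall eps, 0 < eps -> exists T, forall t, (T <= t)%nat -> e t <= eps.
Proof.
  intros HC Ha Hinf Ha0 He Hstep HB eps Heps.
  set (c := C + 1). set (d := eps / 4).
  assert (Hd : 0 < d) by (unfold d; lra).
  assert (Hc : 0 < c) by (unfold c; lra).
  assert (Hdc : 0 < d / c) by (apply Rdiv_lt_0_compat; auto).
  assert (Hae : forall t, 0 <= alpha t * e t) by (intros; apply Rmult_le_pos; auto).
  (* Multiplied by [c / d] below, this tail contributes one further [d], so the final bound is
     [3 * d < eps]. *)
  destruct (bounded_nonneg_series_tail _ B Hae HB (d * (d / c))) as [T1 HT1].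
  { apply Rmult_lt_0_compat; auto. }
  destruct (Ha0 (d / c) Hdc) as [T2 HT2].
  set (T := Nat.max T1 T2).
  set (R' := fun t => rsum t (fun k => alpha k * e k)).
  assert (HR : forall s t, (s <= t)%nat -> R' s <= R' t).
  { intros s t Hst. induction Hst as [|t Hst IH]; [lra|].
    unfold R' in *. rewrite rsum_S. specialize (Hae t). lra. }
  (* Otherwise the bounded weighted sum would dominate [d] times the divergent sum of step sizes. *)
  assert (Hex : exists T0, (T <= T0)%nat /\ e T0 <= d).
  { apply NNPP. intros Hno.
    assert (Hbig : forall t, (T <= t)%nat -> d < e t).
    { intros t Ht. apply Rnot_le_lt. intros Hle. apply Hno. eauto. }
    destruct (Hinf (rsum T alpha + B / d)) as [T3 HT3].
    specialize (HT3 (Nat.max T T3) (Nat.le_max_r _ _)). rewrite sum_f_R0_rsum in HT3.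
    assert (Hle : forall t, (T <= t)%nat -> d * (rsum t alpha - rsum T alpha) <= R' t - R' T).
    { intros t Ht. induction Ht as [|t Ht IH]; [lra|].
      unfold R' in *. rewrite !rsum_S. specialize (Hbig t Ht). specialize (Ha t). nra. }
    specialize (Hle (S (Nat.max T T3)) ltac:(lia)).
    assert (HRT : 0 <= R' T) by (apply rsum_nonneg; auto).
    assert (HRB : R' (S (Nat.max T T3)) <= B) by apply HB.
    assert (HdB : d * (B / d) = B) by (field; lra).
    nra. }
  destruct Hex as (T0 & HT0 & He0). exists T0.
  (* From below [d] one step climbs by at most [d]; above [d] the increment [C * alpha t] is charged
     to the growth of the weighted sum. *)
  assert (Hinv : forall t, (T0 <= t)%nat -> e t <= 2 * d + c / d * (R' t - R' T0)).
  { assert (Hcd : 0 < c / d) by (apply Rdiv_lt_0_compat; auto).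
    intros t Ht. induction Ht as [|t Ht IH]; [lra|].
    assert (Hat : C * alpha t <= d).
    { assert (alpha t <= d / c) by (apply HT2; lia).
      apply Rle_trans with (c * (d / c)); [|right; field; lra].
      apply Rle_trans with (c * alpha t).
      - apply Rmult_le_compat_r; [auto|unfold c; lra].
      - apply Rmult_le_compat_l; lra. }
    specialize (Hstep t).
    destruct (Rle_lt_dec (e t) d) as [Hs|Hs].
    - assert (0 <= c / d * (R' (S t) - R' T0)).
      { apply Rmult_le_pos; [lra|]. specialize (HR T0 (S t) ltac:(lia)). lra. }
      lra.
    - assert (Hsplit : R' (S t) = R' t + alpha t * e t) by reflexivity.
      rewrite Hsplit.
      assert (C * alpha t <= c / d * (alpha t * e t)).
      { apply Rle_trans with (c * alpha t);
          [apply Rmult_le_compat_r; [auto|unfold c; lra]|].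
        replace (c / d * (alpha t * e t)) with (c * alpha t * (e t / d)) by (field; lra).
        rewrite <- (Rmult_1_r (c * alpha t)) at 1.
        apply Rmult_le_compat_l; [apply Rmult_le_pos; [lra|auto]|].
        apply Rmult_le_reg_r with d; [auto|].
        unfold Rdiv. rewrite Rmult_assoc, Rinv_l by lra. lra. }
      replace (c / d * (R' t + alpha t * e t - R' T0)) with
        (c / d * (R' t - R' T0) + c / d * (alpha t * e t)) by ring.
      lra. }
  intros t Ht. specialize (Hinv t Ht).
  assert (Htail : R' t - R' T0 <= d * (d / c)).
  { specialize (HT1 t ltac:(lia)). specialize (HR T1 T0 ltac:(lia)). unfold R' in *. lra. }
  assert (Hcd : 0 <= c / d) by (left; apply Rdiv_lt_0_compat; auto).
  apply Rmult_le_compat_l with (r := c / d) in Htail; [|auto].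
  replace (c / d * (d * (d / c))) with d in Htail by (field; lra).
  unfold d in *. lra.
Qed.

Lemma square_summable (alpha : nat -> R) (l : R) :
  Un_cv (fun T => sum_f_R0 (fun t => alpha t ^ 2) T) l ->
  (forall t, rsum t (fun k => alpha k ^ 2) <= l) /\
  (forall eps, 0 < eps -> exists T, forall t, (T <= t)%nat -> alpha t <= eps).
Proof.
  intros Hl.
  assert (Hsq : forall t, 0 <= alpha t ^ 2) by (intros; apply pow2_ge_0).
  assert (HB : forall t, rsum t (fun k => alpha k ^ 2) <= l).
  { intros t. apply Rle_trans with (sum_f_R0 (fun k => alpha k ^ 2) t).
    - rewrite sum_f_R0_rsum, rsum_S. specialize (Hsq t). lra.
    - apply growing_ineq; [|exact Hl]. intros n. cbv beta. rewrite tech5. specialize (Hsq (S n)). lra. }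
  split; [exact HB|]. intros eps Heps.
  destruct (bounded_nonneg_series_tail _ l Hsq HB (eps ^ 2)) as [T HT];
    [apply pow_lt; auto|].
  exists T. intros t Ht. specialize (HT (S t) ltac:(lia)). rewrite rsum_S in HT.
  assert (Hmono : rsum T (fun k => alpha k ^ 2) <= rsum t (fun k => alpha k ^ 2)).
  { clear HT. induction Ht as [|t Ht IH]; [lra|]. rewrite rsum_S. specialize (Hsq t). lra. }
  apply Rnot_lt_le. intros Hlt. nra.
Qed.

(* [e] is the optimality gap of the total local value and [sum mu (yst - y)] its linearization
   at the reference allocation [yst]; the squared distance between edge flows is the Lyapunov
   function. *)
Lemma distributed_subgradient (N q : nat) (adj : nat -> nat -> bool) (alpha e : nat -> R)
  (y mu : nat -> nat -> nat -> R) (yst : nat -> nat -> R) (M : R) :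
  graph_ok N adj -> assumptionB alpha -> 0 <= M ->
  (forall i t s, (i < N)%nat -> (s < q)%nat ->
     y i (S t) s = y i t s + alpha t * rsum N (fun j => if adj i j then mu i t s - mu j t s else 0)) ->
  (forall s, (s < q)%nat -> rsum N (fun i => y i O s) = rsum N (fun i => yst i s)) ->
  (forall i t s, (i < N)%nat -> (s < q)%nat -> 0 <= mu i t s <= M) ->
  (forall t, 0 <= e t) ->
  (forall t, e t <= rsum N (fun i => rsum q (fun s => mu i t s * (yst i s - y i t s)))) ->
  (forall t, e (S t) <= e t +
     rsum N (fun i => rsum q (fun s => mu i (S t) s * (y i t s - y i (S t) s)))) ->
  forall eps, 0 < eps -> exists T, forall t, (T <= t)%nat -> e t <= eps.
Proof.
  intros HG (Ha & Hinf & l & Hl) HM Hy Hy0 Hmu He Hsub Hstep.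
  destruct (square_summable alpha l Hl) as [Hsq Ha0].
  destruct HG as (Hin & Hsym & Hirr & Hconn).
  assert (HG : graph_ok N adj) by (repeat split; auto; eapply Hin; eauto).
  (* Accumulated flow on each directed edge; its net outflow is the total change of the
     allocation. *)
  set (lam := fun t s i j => rsum t (fun k => alpha k * (mu i k s - mu j k s))).
  assert (Hlam : forall t s i j, lam t s i j = - lam t s j i).
  { intros t s i j. unfold lam.
    rewrite (rsum_ext t _ (fun k => -1 * (alpha k * (mu j k s - mu i k s)))) by (intros; ring).
    rewrite rsum_scal. ring. }
  assert (Hylam : forall t i s, (i < N)%nat -> (s < q)%nat ->
    y i t s = y i O s + net N adj (lam t s) i).
  { intros t i s Hi Hs. induction t as [|t IH].
    - unfold net. rewrite rsum_zero; [ring|]. intros j _. destruct (adj i j); reflexivity.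
    - rewrite Hy, IH by auto.
      assert (Hn := net_plus_scal N adj (lam t s) (fun i j => mu i t s - mu j t s) (alpha t) i).
      change (lam (S t) s) with (fun i j => lam t s i j + alpha t * (mu i t s - mu j t s)).
      rewrite Hn. unfold net at 3. ring. }
  (* A flow carrying the initial allocation to [yst] serves as the optimal point; [V] below is the
     squared distance to it. *)
  destruct (flow_exists N adj (fun i s => yst i s - y i O s) q HG) as (F & HF1 & HF2).
  { intros s Hs. rewrite rsum_minus, Hy0 by auto. ring. }
  set (V := fun t => rsum q (fun s => rsum N (fun i => rsum N (fun j =>
    if adj i j then (lam t s i j - F s i j) ^ 2 else 0)))).
  set (K := INR q * (INR N * (INR N * M ^ 2))).
  assert (HK : 0 <= K).
  { unfold K. repeat apply Rmult_le_pos; try apply pos_INR. lra. lra. lra. }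
  assert (HV : forall t, V (S t) <= V t - 4 * (alpha t * e t) + K * alpha t ^ 2).
  { intros t.
    apply Rle_trans with (rsum q (fun s =>
      rsum N (fun i => rsum N (fun j => if adj i j then (lam t s i j - F s i j) ^ 2 else 0)) +
      4 * alpha t * rsum N (fun i => mu i t s * (y i t s - yst i s)) +
      INR N * (INR N * M ^ 2) * alpha t ^ 2)).
    - apply rsum_le. intros s Hs.
      assert (Hstp := flow_energy_step N adj (fun i j => lam t s i j + -1 * F s i j)
        (fun i => mu i t s) (alpha t) M Hsym).
      rewrite (rsum_ext N (fun i => mu i t s * (y i t s - yst i s))
        (fun i => mu i t s * net N adj (fun i j => lam t s i j + -1 * F s i j) i)).
      2:{ intros i Hi. rewrite net_plus_scal, HF2, (Hylam t) by auto. ring. }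
      eapply Rle_trans; [|eapply Rle_trans; [apply Hstp|]].
      + right. apply rsum_ext. intros i _. apply rsum_ext. intros j _.
        destruct (adj i j); [|reflexivity]. unfold lam. rewrite !rsum_S. ring.
      + intros i j. rewrite Hlam, HF1. ring.
      + intros i Hi. auto.
      + right. f_equal. f_equal. apply rsum_ext. intros i _. apply rsum_ext. intros j _.
        destruct (adj i j); [ring|reflexivity].
    - rewrite !rsum_plus, rsum_scal, rsum_const. fold (V t). unfold K.
      specialize (Hsub t). rewrite rsum_swap in Hsub.
      rewrite (rsum_ext q _ (fun s => -1 * rsum N (fun i => mu i t s * (y i t s - yst i s)))) in Hsub.
      2:{ intros s _. rewrite <- rsum_scal. apply rsum_ext. intros; ring. }
      rewrite rsum_scal in Hsub. specialize (Ha t). nra. }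
  assert (HV0 : forall t, 0 <= V t).
  { intros t. apply rsum_nonneg. intros s _. apply rsum_nonneg. intros i _.
    apply rsum_nonneg. intros j _. destruct (adj i j); [apply pow2_ge_0|lra]. }
  assert (Hacc : forall t, 4 * rsum t (fun k => alpha k * e k) <=
                   V O - V t + K * rsum t (fun k => alpha k ^ 2)).
  { induction t as [|t IH]; [simpl; lra|]. rewrite !rsum_S. specialize (HV t). lra. }
  (* Supplies the one-sided Lipschitz hypothesis of [error_vanishes]. *)
  assert (Hdiff : forall t i s, (i < N)%nat -> (s < q)%nat ->
     mu i (S t) s * (y i t s - y i (S t) s) <= M * (INR N * M) * alpha t).
  { intros t i s Hi Hs. rewrite Hy by auto. destruct (Hmu i (S t) s Hi Hs) as [H1 H2].
    set (g := rsum N (fun j => if adj i j then mu i t s - mu j t s else 0)).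
    assert (Hg : - g <= INR N * M).
    { rewrite <- rsum_const. unfold g. rewrite <- (Rmult_1_l (rsum N _)), Ropp_mult_distr_l.
      rewrite <- rsum_scal. apply rsum_le. intros j Hj.
      specialize (Hmu i t s Hi Hs) as H3. specialize (Hmu j t s Hj Hs) as H4.
      destruct (adj i j); lra. }
    replace (y i t s - (y i t s + alpha t * g)) with (alpha t * - g) by ring.
    specialize (Ha t). pose proof (pos_INR N).
    apply Rle_trans with (mu i (S t) s * (alpha t * (INR N * M))).
    - apply Rmult_le_compat_l; [auto|]. apply Rmult_le_compat_l; auto.
    - replace (M * (INR N * M) * alpha t) with (M * (alpha t * (INR N * M))) by ring.
      apply Rmult_le_compat_r; [|auto]. repeat apply Rmult_le_pos; auto. }
  apply (error_vanishes alpha e (INR N * (INR q * (M * (INR N * M)))) ((V O + K * l) / 4)); auto.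
  - repeat apply Rmult_le_pos; auto using pos_INR.
  - intros t. apply Rle_trans with (1 := Hstep t). apply Rplus_le_compat_l.
    apply Rle_trans with (rsum N (fun i => rsum q (fun s => M * (INR N * M) * alpha t))).
    + apply rsum_le. intros i Hi. apply rsum_le. intros s Hs. auto.
    + right. rewrite !rsum_const. ring.
  - intros t. specialize (Hacc t). specialize (HV0 t). specialize (Hsq t).
    assert (K * rsum t (fun k => alpha k ^ 2) <= K * l) by (apply Rmult_le_compat_l; auto).
    lra.
Qed.

(** * Conservation of the total allocation, and finite-time feasibility *)

Lemma allocation_sum_invariant (N : nat) (adj : nat -> nat -> bool) (a : nat -> R)
  (y mu : nat -> nat -> R) :
  (forall i j, adj i j = adj j i) ->
  (forall i t, (i < N)%nat -> y i (S t) =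
     y i t + a t * rsum N (fun j => if adj i j then mu i t - mu j t else 0)) ->
  forall t, rsum N (fun i => y i t) = rsum N (fun i => y i O).
Proof.
  intros Hadj Hy. induction t as [|t IH]; [reflexivity|].
  rewrite (rsum_ext N _ (fun i => y i t + a t * net N adj (fun i j => mu i t - mu j t) i))
    by (intros; apply Hy; auto).
  rewrite rsum_plus, rsum_scal, IH, antisymmetric_net_zero; [ring|auto|intros; ring].
Qed.

Theorem theorem3 (P : milp_data)
  (hZ : forall i, (i < nag P)%nat -> (nint P i <= dim P i)%nat)
  (hX : X_nonempty_compact P)
  (hfeas : milp_feasible P)
  (L : nat -> nat -> R) (hL : is_Lmin P L)
  (xL : nat -> nat -> R) (ltil : nat -> R) (hxL : is_xL_opt P L xL ltil)
  (delta : R) (hdelta : 0 < delta)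
  (hA : assumptionA P (sigma_asy P L xL + delta))
  (adj : nat -> nat -> bool) (hG : graph_ok (nag P) adj) :
  exists M0 : R, forall M : R, 0 < M -> M0 <= M ->
    forall alpha : nat -> R, assumptionB alpha ->
    forall (y z : nat -> nat -> nat -> R) (v : nat -> nat -> R)
           (mu x : nat -> nat -> nat -> R),
      (forall s, (s < ncons P)%nat ->
         rsum (nag P) (fun i => y i O s) = bvec P s - (sigma_asy P L xL + delta)) ->
      algorithm_run P adj M alpha y z v mu x ->
      exists T : nat, (0 < T)%nat /\
        forall t, (T <= t)%nat -> milp_feasible_pt P (fun i => x i t).
Proof.
  destruct hA as (zs & Hopt & Huniq).
  set (rr := sigma_asy P L xL + delta) in *.
  assert (Hsupp : forall i, (i < nag P)%nat -> finite_support (dim P i) (inX P i)).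
  { intros i Hi. apply milp_finite_support; [auto|apply hX; auto]. }
  destruct (exact_penalty P rr zs Hsupp Hopt) as (m0 & Hm0 & Hpen).
  destruct (sharp_optimum P rr zs Hsupp Hopt Huniq) as (K & HK & Hsharp).
  (* One unit above the penalty threshold [m0] makes the gap [e] dominate the total violation
     [w]. *)
  exists (m0 + 1). intros M HM HM0 alpha HB y z v mu x Hinit (Hpd & Hupd & Hx).
  set (w := fun t => rsum (nag P) (fun i => v i t)).
  set (e := fun t => rsum (nag P) (fun i => loc_obj P i M (z i t) (v i t)) - total_cost P zs).
  assert (Hzv : forall i t, (i < nag P)%nat -> loc_feas P i (y i t) (z i t) (v i t)).
  { intros i t Hi. apply (Hpd i t Hi). }
  assert (Hw : forall t, 0 <= w t).
  { intros t. apply rsum_nonneg. intros i Hi. apply (Hzv i t Hi). }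
  assert (Hsum : forall t s, (s < ncons P)%nat ->
    rsum (nag P) (fun i => y i t s) = bvec P s - rr).
  { intros t s Hs. rewrite <- (Hinit s Hs).
    apply (allocation_sum_invariant (nag P) adj alpha (fun i t => y i t s) (fun i t => mu i t s));
      [apply hG|auto]. }
  assert (Hcoup : forall t s, (s < ncons P)%nat ->
    rsum (nag P) (fun i => Arow P i s (z i t)) <= bvec P s - rr + w t).
  { intros t s Hs. rewrite <- (Hsum t s Hs). unfold w. rewrite <- rsum_plus.
    apply rsum_le. intros i Hi. apply (Hzv i t Hi); auto. }
  assert (He : forall t, e t = total_cost P (fun i => z i t) + M * w t - total_cost P zs).
  { intros t. unfold e, loc_obj. rewrite rsum_plus, rsum_scal. reflexivity. }
  assert (Hwe : forall t, w t <= e t).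
  { intros t. rewrite He.
    assert (H := Hpen (fun i => z i t) (w t) (fun i Hi => proj1 (Hzv i t Hi)) (Hw t) (Hcoup t)).
    specialize (Hw t). nra. }
  (* An allocation that supports [zs] and has the required total: the slack of each coupling
     constraint is split equally among the agents. *)
  set (yst := fun i s => Arow P i s (zs i) +
    (bvec P s - rr - rsum (nag P) (fun i => Arow P i s (zs i))) / INR (nag P)).
  assert (Hyst : forall i s, (i < nag P)%nat -> (s < ncons P)%nat -> Arow P i s (zs i) <= yst i s).
  { intros i s Hi Hs. assert (H := proj2 (proj1 Hopt) s Hs).
    assert (HN : 0 < INR (nag P)) by (apply lt_0_INR; lia).
    unfold yst, Rdiv. assert (0 < / INR (nag P)) by (apply Rinv_0_lt_compat; auto).
    nra. }
  assert (Hconv : forall eps, 0 < eps -> exists T, forall t, (T <= t)%nat -> e t <= eps).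
  { apply (distributed_subgradient (nag P) (ncons P) adj alpha e y mu yst M hG HB); auto.
    - lra.
    - intros s Hs. rewrite Hsum by auto. unfold yst. rewrite rsum_plus, rsum_const.
      (* Without agents the division in [yst] is by zero, but then both totals are empty sums. *)
      destruct (Nat.eq_dec (nag P) 0) as [E|E].
      + rewrite <- (Hsum O s Hs), E. simpl. ring.
      + field. apply not_0_INR; auto.
    - intros i t s Hi Hs.
      apply (multiplier_bounds P i M (y i t) (z i t) (v i t)); auto.
    - intros t. apply Rle_trans with (w t); auto.
    - intros t. unfold e.
      enough (rsum (nag P) (fun i => loc_obj P i M (z i t) (v i t)) <=
        rsum (nag P) (fun i => loc_obj P i M (zs i) 0 +
          rsum (ncons P) (fun s => mu i t s * (yst i s - y i t s)))) as H.
      { rewrite rsum_plus in H. unfold loc_obj at 2 in H. rewrite rsum_plus, rsum_const in H.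
        unfold total_cost. lra. }
      apply rsum_le. intros i Hi. apply local_value_subgradient; auto.
      split; [apply Hopt; auto|]. split; [lra|].
      intros s Hs. rewrite Rplus_0_r. auto.
    - intros t. unfold e.
      enough (rsum (nag P) (fun i => loc_obj P i M (z i (S t)) (v i (S t))) <=
        rsum (nag P) (fun i => loc_obj P i M (z i t) (v i t) +
          rsum (ncons P) (fun s => mu i (S t) s * (y i t s - y i (S t) s)))) as H.
      { rewrite rsum_plus in H. lra. }
      apply rsum_le. intros i Hi. apply local_value_subgradient; auto. }
  (* Chosen so that the [eps] terms of all agents together fit into [delta]; the added 1 keeps the
     denominator positive. *)
  set (eps := delta / (INR (nag P) + 1)).
  pose proof (pos_INR (nag P)) as HN.
  assert (Heps : 0 < eps) by (apply Rdiv_lt_0_compat; lra).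
  (* A row of [zs i] exceeds [y i t] by at most [K * e t] from sharpness plus [v i t <= w t <= e t],
     hence the divisor [K + 1]. *)
  destruct (Hconv (eps / (K + 1))) as [T HT]; [apply Rdiv_lt_0_compat; lra|].
  exists (S T). split; [lia|]. intros t Ht. specialize (HT t ltac:(lia)).
  apply (rounding_feasible P L xL ltil delta eps zs (fun i => y i t)); auto.
  - lra.
  - apply Rle_trans with ((INR (nag P) + 1) * eps);
      [apply Rmult_le_compat_r; lra|right; unfold eps; field; lra].
  - intros i s Hi Hs.
    assert (He0 : 0 <= e t) by (apply Rle_trans with (w t); auto).
    (* The gap [e t] bounds both the coupling violation [w t] and, because [M * w t >= 0], the
       excess cost. *)
    assert (Hz : Arow P i s (zs i) <= Arow P i s (z i t) + K * e t).
    { apply (Hsharp (fun i => z i t)); auto.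
      - intros j Hj. apply (Hzv j t Hj).
      - intros s' Hs'. specialize (Hcoup t s' Hs'). specialize (Hwe t). lra.
      - rewrite He. specialize (Hw t). nra. }
    destruct (Hzv i t Hi) as (_ & _ & Hy). specialize (Hy s Hs).
    assert (Hv : v i t <= w t).
    { apply (rsum_term_le _ i (fun i => v i t)); [|auto]. intros j Hj. apply (Hzv j t Hj). }
    specialize (Hwe t).
    assert (HKe : (K + 1) * e t <= eps).
    { apply Rmult_le_compat_l with (r := K + 1) in HT; [|lra].
      replace ((K + 1) * (eps / (K + 1))) with eps in HT by (field; lra). exact HT. }
    lra.
Qed.
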